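(* Let $n\ge 3$, let $\mathcal{M}$ be a (nonempty, finite) collection of lines in general linear position in $\mathbb{P}^n$, let $S=\mathbb{C}[x_0,\ldots,x_n]$, and let $R$ be the coordinate ring of $\mathcal{M}$. If $|\mathcal{M}|=1$, then $\mathrm{pdim}_S(R)=n-1$, $\mathrm{depth}(R)=2$, and $\dim(R)=2$. If $|\mathcal{M}|\ge 2$, then $\mathrm{pdim}_S(R)=n$, $\mathrm{depth}(R)=1$, and $\dim(R)=2$. In particular, $R$ is Cohen-Macaulay if and only if $|\mathcal{M}|=1$.
   Context: Let $\mathbb{P}^n$ be projective $n$-space over $\mathbb{C}$ with homogeneous coordinate ring $S=\mathbb{C}[x_0,\ldots,x_n]$ (standard grading). The defining ideal of a line in $\mathbb{P}^n$ is the ideal of $S$ of all forms vanishing on it. For a collection $\mathcal{M}=\{\mathcal{L}_1,\ldots,\mathcal{L}_m\}$ of lines with defining ideals $L_1,\ldots,L_m$, the defining ideal of $\mathcal{M}$ is $J=\bigcap_{i=1}^m L_i$ and the coordinate ring of $\mathcal{M}$ is $R=S/J$. The lines of $\mathcal{M}$ are in general linear position if any $s$ of the lines span a $\mathbb{P}^r$ with $r=\min\{2s-1,n\}$. Here $\mathrm{pdim}_S(R)$ is the length of the minimal graded free resolution of $R$ over $S$, $\mathrm{depth}(R)$ is the maximal length of an $R$-regular sequence of elements of the maximal homogeneous ideal, $\dim(R)$ is Krull dimension, and $R$ is Cohen-Macaulay if $\mathrm{depth}(R)=\dim(R)$. *)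

(* Defs.v *)
From HB Require Import structures.
From mathcomp Require Import all_boot all_order all_algebra.
From mathcomp Require Import finmap generic_quotient ring_quotient.
From mathcomp Require Import boolp reals complex.
From mathcomp Require Import mpoly.

Set Implicit Arguments.
Unset Strict Implicit.
Unset Printing Implicit Defensive.

Import GRing.Theory.
Local Open Scope ring_scope.

Section CommutativeAlgebra.
Variable A : comNzRingType.

Definition in_ideal_gen (G : A -> Prop) (x : A) : Prop :=
  exists s : seq (A * A),
    (forall p, p \in s -> G p.2) /\ x = \sum_(p <- s) p.1 * p.2.

Definition has_krull_dim (d : nat) : Prop :=
  let chain (k : nat) (P : 'I_k.+1 -> prime_idealr A) :=
    forall i j : 'I_k.+1, (i < j)%N ->
      {subset P i <= P j} /\ ~ {subset P j <= P i} in
  (exists P : 'I_d.+1 -> prime_idealr A, chain d P) /\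
  (forall (k : nat) (P : 'I_k.+1 -> prime_idealr A), chain k P -> (k <= d)%N).

Variable V : lmodType A.

(* membership in the submodule (s_0, ..., s_(r-1)) V *)
Definition in_seq_mul (s : seq A) (x : V) : Prop :=
  exists y : 'I_(size s) -> V, x = \sum_(i < size s) s`_i *: y i.

Definition regular_seq (s : seq A) : Prop :=
  (forall i : nat, (i < size s)%N -> forall x : V,
     in_seq_mul (take i s) (s`_i *: x) -> in_seq_mul (take i s) x) /\
  ~ (forall x : V, in_seq_mul s x).

Definition has_depth (I : A -> Prop) (d : nat) : Prop :=
  let in_I_regular (s : seq A) := (forall a, a \in s -> I a) /\ regular_seq s in
  (exists s, in_I_regular s /\ size s = d) /\
  (forall s, in_I_regular s -> (size s <= d)%N).

End CommutativeAlgebra.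

Section GradedResolutions.
Variables (K : fieldType) (n : nat).
Local Notation S := {mpoly K[n]}.

Definition max_homog_ideal (f : S) : Prop :=
  in_ideal_gen (fun g : S => exists i : 'I_n, g = 'X_i) f.

(* homogeneity in an integer degree: 0 is the only form of negative degree *)
Definition zhomog (d : int) (f : S) : bool :=
  if d is Posz e then f \is e.-homog else f == 0.

Variables (V : lmodType S) (Vdeg : int -> V -> Prop).

(* The i-th free module is the direct sum of the S(- shift i j), j < rank i,
   with elements written as row vectors; diff i is the map from step i.+1 to
   step i, acting by right multiplication. *)
Record free_complex := FreeComplex {
  rank : nat -> nat;
  shift : forall i : nat, 'I_(rank i) -> int;
  diff : forall i : nat, 'M[S]_(rank i.+1, rank i);
  aug : {linear 'rV[S]_(rank 0) -> V}
}.

Definition graded_complex (F : free_complex) : Prop :=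
  (forall (i : nat) (j : 'I_(rank F i.+1)) (k : 'I_(rank F i)),
     zhomog (shift j - shift k) (diff F i j k)) /\
  (forall k : 'I_(rank F 0), Vdeg (shift k) (aug F (delta_mx 0 k))).

Definition exact_complex (F : free_complex) : Prop :=
  [/\ forall x : V, exists u, aug F u = x,
      forall u, aug F u = 0 <-> exists v, u = v *m diff F 0
    & forall (i : nat) (u : 'rV_(rank F i.+1)),
        u *m diff F i = 0 <-> exists v, u = v *m diff F i.+1].

Definition minimal_complex (F : free_complex) : Prop :=
  forall (i : nat) (j : 'I_(rank F i.+1)) (k : 'I_(rank F i)),
    max_homog_ideal (diff F i j k).

Definition minimal_graded_free_resolution (F : free_complex) : Prop :=
  [/\ graded_complex F, exact_complex F & minimal_complex F].

Definition has_length (F : free_complex) (l : nat) : Prop :=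
  rank F l <> 0%N /\ forall i, (l < i)%N -> rank F i = 0%N.

(* "the" minimal graded free resolution: one exists, and all have length d *)
Definition has_pdim (d : nat) : Prop :=
  (exists F, minimal_graded_free_resolution F) /\
  (forall F, minimal_graded_free_resolution F -> has_length F d).

End GradedResolutions.

Section Lines.
Variables (K : fieldType) (n : nat).
Local Notation S := {mpoly K[n.+1]}.

(* A line of P^n is given by the 2-dimensional linear subspace of K^(n+1)
   over it. *)
Record line := Line {
  cone :> {vspace 'rV[K]_n.+1};
  dim_cone : \dim cone == 2
}.
HB.instance Definition _ := [isSub for cone].
HB.instance Definition _ := [Choice of line by <:].

(* Nonemptiness is bundled so that the defining ideal is proper and the quotient
   is a nonzero ring. *)
Record line_collection := LineCollection {
  lines :> {fset line};
  lines_neq0 : lines != fset0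
}.

Definition proj_dim (U : {vspace 'rV[K]_n.+1}) : nat := (\dim U).-1.

Definition general_linear_position (M : {fset line}) : Prop :=
  forall A : {fset line}, (A `<=` M)%fset -> A != fset0 ->
    proj_dim (\sum_(l <- A) cone l)%VS = minn (2 * #|` A| - 1) n.

(* v ranges over representatives of the points of the line; the value at v is
   meaningful as a vanishing condition only for forms. *)
Definition vanishes_on (l : line) (f : S) : Prop :=
  forall v : 'rV[K]_n.+1, v \in cone l -> v != 0 -> f.@[v 0] = 0.

Definition line_ideal (l : line) (f : S) : Prop :=
  in_ideal_gen
    (fun g : S => (exists d, g \is d.-homog) /\ vanishes_on l g) f.

Definition defining_ideal (M : line_collection) : {pred S} :=
  fun f => `[< forall l, l \in lines M -> line_ideal l f >].

Lemma line_ideal_vanishes l f : line_ideal l f -> vanishes_on l f.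
Proof.
move=> [s [sG ->]] v vl v0; rewrite raddf_sum /= big1_seq // => p /andP[_ ps].
by have [_ gv] := sG _ ps; rewrite mevalM (gv v vl v0) mulr0.
Qed.

Lemma defining_ideal_closed M : idealr_closed (defining_ideal M).
Proof.
split.
- apply/asboolP => l _; exists [::]; split => //; by rewrite big_nil.
- apply/asboolP => H.
  have [l lM] := fset0Pn _ (lines_neq0 M).
  have := vpick0 (cone l); set v := vpick _ => v0E.
  have v0 : v != 0.
    by rewrite v0E; apply/eqP => l0; have := dim_cone l; rewrite l0 dimv0.
  have := line_ideal_vanishes (H l lM) (memv_pick _) v0.
  by rewrite meval1 => /eqP; rewrite oner_eq0.
move=> a u v /asboolP Hu /asboolP Hv; apply/asboolP => l lM.
have [s [sG ->]] := Hu l lM; have [t [tG ->]] := Hv l lM.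
exists ([seq (a * p.1, p.2) | p <- s] ++ t); split=> [p|].
  by rewrite mem_cat => /orP[/mapP[q qs ->]|]; [exact: (sG q qs) | exact: tG].
rewrite big_cat big_map mulr_sumr; congr (_ + _).
by apply: eq_bigr => p _; rewrite mulrA.
Qed.

HB.instance Definition _ M :=
  isIdealr.Build S (defining_ideal M) (defining_ideal_closed M).

Definition coord_ring (M : line_collection) : Type :=
  {ideal_quot (defining_ideal M)}.
HB.instance Definition _ M := GRing.ComNzRing.on (coord_ring M).

Definition coord_ring_pi (M : line_collection) (f : S) : coord_ring M :=
  (\pi_({ideal_quot (defining_ideal M)}) f)%qT.

Definition coord_ring_scale M (a : S) (x : coord_ring M) : coord_ring M :=
  coord_ring_pi M a * x.

Section Lmod.
Variable M : line_collection.
Fact coord_scaleA a b x :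
  @coord_ring_scale M a (coord_ring_scale b x) = coord_ring_scale (a * b) x.
Proof. by rewrite /coord_ring_scale /coord_ring_pi rmorphM mulrA. Qed.
Fact coord_scale1 : left_id 1 (@coord_ring_scale M).
Proof. by move=> x; rewrite /coord_ring_scale /coord_ring_pi rmorph1 mul1r. Qed.
Fact coord_scaleDr : right_distributive (@coord_ring_scale M) +%R.
Proof. by move=> a x y; rewrite /coord_ring_scale mulrDr. Qed.
Fact coord_scaleDl x :
  {morph (@coord_ring_scale M)^~ x : a b / a + b}.
Proof. by move=> a b; rewrite /coord_ring_scale /coord_ring_pi rmorphD mulrDl. Qed.
HB.instance Definition _ := GRing.Zmodule_isLmodule.Build S (coord_ring M)
  coord_scaleA coord_scale1 coord_scaleDr coord_scaleDl.
End Lmod.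

Definition coord_ring_deg (M : line_collection) (d : int) (x : coord_ring M) :
    Prop :=
  exists2 f : S, zhomog d f & x = coord_ring_pi M f.

Definition has_coord_pdim (M : line_collection) : nat -> Prop :=
  has_pdim (@coord_ring_deg M).

Definition has_coord_depth (M : line_collection) : nat -> Prop :=
  has_depth (coord_ring M) (@max_homog_ideal K n.+1).

Definition has_coord_dim (M : line_collection) : nat -> Prop :=
  has_krull_dim (coord_ring M).

Definition cohen_macaulay (M : line_collection) : Prop :=
  exists d, has_coord_depth M d /\ has_coord_dim M d.

End Lines.

(* Main.v *)
From HB Require Import structures.
Require Import Defs.
From mathcomp Require Import all_boot all_order all_algebra.
From mathcomp Require Import finmap reals complex.
From mathcomp Require Import generic_quotient ring_quotient boolp mpoly.
From mathcomp Require Import zify ring.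

(* Restriction to a line is a linear substitution [S -> K[s, t]] whose kernel
   is the ideal of the line.

   Dimension: a prime containing an intersection of line ideals contains one of
   them, and the quotient by a line has quadratic growth, while each strict
   inclusion of primes lowers the order of growth by one.

   Depth: if the lines are at least two, let [L] be the ideal of one of them and
   [L'] the ideal of the others.  Two of the lines are disjoint, so a power of
   every form of positive degree lies in [L + L'], and [S / (L + L')] has a
   nonzero socle element [z].  For a nonzerodivisor [a], writing [a z = p + x]
   with [p] in [L] and [x] in [L'] yields a nonzero socle element [x] of
   [R / a R].

   Projective dimension: let [y_1, ..., y_N] be a basis of the linear forms whose
   first [d] elements are a regular sequence on [R].  The homology of a minimal
   resolution [F] modulo all the [y_k] is [F] tensored with [K].  Passing from
   [k] to [k + 1] forms shifts the top nonvanishing homology up by one degree,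
   except while [k < d], and turns a class killed by [y_(k+1)] into a nonzero
   class one degree higher; so a socle element of [R / (y_1, ..., y_d) R] gives
   a nonzero class in the top degree [N - d].  A minimal resolution exists
   because [S] is noetherian. *)

Set Implicit Arguments.
Unset Strict Implicit.
Unset Printing Implicit Defensive.

Import GRing.Theory Num.Theory.
Local Open Scope ring_scope.

(** * Linear substitutions *)

Section LinearSubstitution.
Variable K : fieldType.

Lemma mpoly_ring_ind n (P : {mpoly K[n]} -> Prop) :
    (forall c, P c%:MP) -> (forall i, P 'X_i) ->
    (forall f g, P f -> P g -> P (f + g)) ->
    (forall f g, P f -> P g -> P (f * g)) ->
  forall f, P f.
Proof.
move=> PC PX PD PM; apply: mpolyind => [|c m f _ _ Pf].
  by rewrite -mpolyC0; exact: PC.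
apply: PD Pf; rewrite -mul_mpolyC; apply: (PM) => //.
rewrite mpolyXE_id; apply: big_ind => [||i _]; first by rewrite -mpolyC1.
  exact: PM.
by elim: (m i) => [|k IH]; rewrite ?expr0 -?mpolyC1// exprS; apply: PM.
Qed.

(** The set of [f] with [phi f - psi f] in [I] is closed under products, since [phi f * phi g - psi
    f * psi g = (phi f - psi f) * phi g + psi f * (phi g - psi g)]. Two substitutions can thus be
    compared on the variables alone. *)
Lemma rmorph_congr n (A : nzRingType) (I : A -> Prop)
    (phi psi : {rmorphism {mpoly K[n]} -> A}) :
    I 0 -> (forall a b, I a -> I b -> I (a + b)) ->
    (forall a b, I b -> I (a * b)) -> (forall a b, I a -> I (a * b)) ->
    (forall c, phi c%:MP = psi c%:MP) -> (forall i, I (phi 'X_i - psi 'X_i)) ->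
  forall f, I (phi f - psi f).
Proof.
move=> I0 ID IMl IMr eqC IX; apply: mpoly_ring_ind => // [c|f g If Ig|f g If Ig].
- by rewrite eqC subrr.
- by rewrite !rmorphD opprD addrACA; apply: ID.
rewrite !rmorphM.
have -> : phi f * phi g - psi f * psi g =
    (phi f - psi f) * phi g + psi f * (phi g - psi g).
  by rewrite mulrBl mulrBr addrA subrK.
by apply: ID; [apply: IMr | apply: IMl].
Qed.

(** Pullback of [f] along the linear map [v |-> v *m C] on row vectors. When the rows of [C] are a
    basis of a subspace, this is restriction to that subspace in coordinates. *)
Definition linsub p q (C : 'M[K]_(p, q)) (f : {mpoly K[q]}) : {mpoly K[p]} :=
  f \mPo [tuple \sum_(i < p) C i j *: 'X_i | j < q].

Section Morphism.
Variables (p q : nat) (C : 'M[K]_(p, q)).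
HB.instance Definition _ := GRing.LRMorphism.copy (linsub C)
  (comp_mpoly [tuple \sum_(i < p) C i j *: 'X_i | j < q]).
End Morphism.

Lemma linsubX p q (C : 'M[K]_(p, q)) j : linsub C 'X_j = \sum_i C i j *: 'X_i.
Proof. by rewrite /linsub comp_mpolyXU -tnth_nth tnth_mktuple. Qed.

Lemma linsubC p q (C : 'M[K]_(p, q)) c : linsub C c%:MP = c%:MP.
Proof. exact: comp_mpolyC. Qed.

Lemma linsub_comp p q r (C : 'M[K]_(p, q)) (B : 'M[K]_(q, r)) f :
  linsub C (linsub B f) = linsub (C *m B) f.
Proof.
elim/mpoly_ring_ind: f => [c|j|f g IHf IHg|f g IHf IHg].
- by rewrite !linsubC.
- rewrite !linsubX linear_sum /=.
  under eq_bigr => i _ do rewrite linearZ /= linsubX scaler_sumr.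
  rewrite exchange_big; apply: eq_bigr => i _.
  by rewrite mxE scaler_suml; apply: eq_bigr => k _; rewrite scalerA mulrC.
- by rewrite !rmorphD /= IHf IHg.
by rewrite !rmorphM /= IHf IHg.
Qed.

Lemma linsub1 p (f : {mpoly K[p]}) : linsub 1%:M f = f.
Proof.
elim/mpoly_ring_ind: f => [c|j|f g IHf IHg|f g IHf IHg].
- by rewrite linsubC.
- rewrite linsubX (bigD1 j) //= mxE eqxx scale1r big1 ?addr0 // => i /negPf ij.
  by rewrite mxE ij scale0r.
- by rewrite rmorphD /= IHf IHg.
by rewrite rmorphM /= IHf IHg.
Qed.

Lemma linsub0 p q (f : {mpoly K[q]}) : linsub (0 : 'M_(p, q)) f = (f@_0)%:MP.
Proof.
elim/mpoly_ring_ind: f => [c|j|f g IHf IHg|f g IHf IHg].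
- by rewrite linsubC mcoeffC eqxx mulr1.
- rewrite linsubX big1 => [|i _]; last by rewrite mxE scale0r.
  by rewrite mcoeffX mnm1_eq0 mpolyC0.
- by rewrite rmorphD mcoeffD mpolyCD /= IHf IHg.
by rewrite !rmorphM /= IHf IHg.
Qed.

Lemma meval_linsub p q (C : 'M[K]_(p, q)) f (v : 'rV_p) :
  (linsub C f).@[v 0] = f.@[(v *m C) 0].
Proof.
rewrite /linsub comp_mpoly_meval; apply: meval_eq => j.
rewrite tnth_mktuple raddf_sum mxE; apply: eq_bigr => i _ /=.
by rewrite mevalZ mevalXU mulrC.
Qed.

Lemma linform_homog p (c : 'I_p -> K) : \sum_i c i *: 'X_i \is 1.-homog.
Proof. by apply: rpred_sum => i _; apply: rpredZ; rewrite dhomogX /= mdeg1. Qed.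

Lemma linsub_homog p q (C : 'M[K]_(p, q)) d f :
  f \is d.-homog -> linsub C f \is d.-homog.
Proof.
move=> /dhomogP hf; rewrite [f]mpolyE linear_sum /= big_seq; apply: rpred_sum.
move=> m /hf <-; rewrite linearZ /= rpredZ // mpolyXE_id rmorph_prod /=.
rewrite mdegE; elim/big_rec2: _ => [|i d' g _ hg]; first exact: dhomog1.
apply: dhomogM => //; rewrite rmorphXn -[X in X.-homog]mul1n; apply: dhomogMn.
by rewrite /= linsubX linform_homog.
Qed.

Lemma mcoeff_pihomog n (d : nat) (f : {mpoly K[n]}) m :
  (pihomog mdeg d f)@_m = if mdeg m == d then f@_m else 0.
Proof.
rewrite pihomogE raddf_sum /= big_mkcond /=.
have h m' : m' != m -> (if mdeg m' == d then (f@_m' *: 'X_[m'])@_m else 0) = 0.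
  by case: ifP => // _ /negPf ne; rewrite mcoeffZ mcoeffX ne mulr0.
case: (boolP (m \in msupp f)) => mf.
  rewrite (bigD1_seq m) ?msupp_uniq //= mcoeffZ mcoeffX eqxx mulr1.
  by rewrite big1 ?addr0.
rewrite big_seq big1 => [|m' m'f]; last by apply: h; apply: contraNneq mf => <-.
by rewrite (memN_msupp_eq0 mf); case: ifP.
Qed.

Lemma linsub_pihomog p q (C : 'M[K]_(p, q)) d f :
  pihomog mdeg d (linsub C f) = linsub C (pihomog mdeg d f).
Proof.
rewrite {1}[f](@pihomog_partitionE _ _ mdeg (msize f)) //.
rewrite (raddf_sum (linsub C)) (raddf_sum (pihomog mdeg d)).
have h k : pihomog mdeg d (linsub C (pihomog mdeg k f)) =
    if d == k then linsub C (pihomog mdeg k f) else 0.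
  have hk := linsub_homog C (pihomogP mdeg k f).
  case: eqVneq => [->|ne]; first exact: pihomog_dE.
  by rewrite (pihomog_ne0 _ hk) // eq_sym.
rewrite (eq_bigr _ (fun (k : 'I_(msize f)) _ => h k)).
rewrite -big_mkcond /=; case: (ltnP d (msize f)) => dm.
  by rewrite (big_pred1 (Ordinal dm)).
rewrite big1 => [|k /eqP kd]; last by move: (ltn_ord k); rewrite -kd ltnNge dm.
suff -> : pihomog mdeg d f = 0 by rewrite raddf0.
apply/mpolyP => m; rewrite mcoeff_pihomog mcoeff0; case: eqP => // md.
by apply/memN_msupp_eq0/msize_mdeg_ge; rewrite md.
Qed.

Lemma linsub_section p q (C : 'M[K]_(p, q)) (G : 'M[K]_(q, p)) f :
  C *m G = 1%:M -> linsub C (linsub G f) = f.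
Proof. by move=> CG; rewrite linsub_comp CG linsub1. Qed.

Lemma in_ideal_gen0 (A : comNzRingType) (G : A -> Prop) : in_ideal_gen G 0.
Proof. by exists [::]; rewrite big_nil. Qed.

Lemma in_ideal_gen_mem (A : comNzRingType) (G : A -> Prop) x :
  G x -> in_ideal_gen G x.
Proof.
move=> Gx; exists [:: (1, x)]; rewrite big_seq1 mul1r; split=> // p.
by rewrite inE => /eqP ->.
Qed.

Lemma in_ideal_genD (A : comNzRingType) (G : A -> Prop) x y :
  in_ideal_gen G x -> in_ideal_gen G y -> in_ideal_gen G (x + y).
Proof.
move=> [s [hs ->]] [t [ht ->]]; exists (s ++ t); rewrite big_cat; split=> // p.
by rewrite mem_cat => /orP[/hs|/ht].
Qed.

Lemma in_ideal_genMl (A : comNzRingType) (G : A -> Prop) a x :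
  in_ideal_gen G x -> in_ideal_gen G (a * x).
Proof.
move=> [s [hs ->]]; exists [seq (a * p.1, p.2) | p <- s]; split=> [p|].
  by case/mapP=> r /hs hr ->.
by rewrite big_map mulr_sumr; apply: eq_bigr => r _; rewrite mulrA.
Qed.

(** If [f] restricts to 0, so does its pullback along the projector [G *m C], hence [f] is the
    difference of [f] and that pullback. On a variable this difference is a linear form, killed by
    [linsub C] because [C *m G *m C = C]. *)
Lemma linsub_kernel p q (C : 'M[K]_(p, q)) (G : 'M[K]_(q, p)) f :
    C *m G = 1%:M -> linsub C f = 0 ->
  in_ideal_gen (fun g => g \is 1.-homog /\ linsub C g = 0) f.
Proof.
move=> CG f0; set I := in_ideal_gen _.
have -> : f = linsub 1%:M f - linsub (G *m C) f.
  by rewrite linsub1 -linsub_comp f0 raddf0 subr0.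
apply: rmorph_congr.
- exact: in_ideal_gen0.
- exact: in_ideal_genD.
- exact: in_ideal_genMl.
- by move=> a b Ia; rewrite mulrC; apply: in_ideal_genMl.
- by move=> c; rewrite /= !linsubC.
move=> i; apply: in_ideal_gen_mem; split.
  by rewrite /= !linsubX rpredB ?linform_homog.
by rewrite raddfB /= !linsub_comp mulmx1 mulmxA CG mul1mx subrr.
Qed.

(** As a substitution, this sets the first [k] variables to 0 and keeps the others. *)
Definition killmx n (k : nat) : 'M[K]_n :=
  \matrix_(i, j) ((i == j) && (k <= i)%N)%:R.

Lemma linsub_killX n k (j : 'I_n) :
  linsub (killmx n k) 'X_j = if (k <= j)%N then 'X_j else 0.
Proof.
rewrite linsubX (bigD1 j) //= mxE eqxx big1 => [|i /negPf ij].
  by rewrite addr0; case: leqP; rewrite ?scale1r ?scale0r.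
by rewrite mxE ij scale0r.
Qed.

Lemma killmx_mul n k k' : killmx n k *m killmx n k' = killmx n (maxn k k').
Proof.
apply/matrixP => i j; rewrite !mxE (bigD1 i) //= !mxE eqxx big1 => [|l /negPf li].
  by rewrite addr0 -natrM mulnb geq_max andbCA.
by rewrite !mxE eq_sym li mul0r.
Qed.

Lemma killmx0 n : killmx n 0 = 1%:M.
Proof. by apply/matrixP => i j; rewrite !mxE andbT. Qed.

Lemma killmx_full n : killmx n n = 0.
Proof. by apply/matrixP => i j; rewrite !mxE leqNgt ltn_ord andbF. Qed.

(** Setting ['X_k] to 0 moves each variable by a multiple of ['X_k], hence moves [f] by such a
    multiple. *)
Lemma mulX_of_kill n (k : 'I_n) (f : {mpoly K[n]}) :
  exists g, f = linsub (\matrix_(i, j) ((i == j) && (i != k))%:R) f + 'X_k * g.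
Proof.
set B := \matrix_(i, j) _.
have hB i j : B i j = if i == k then 0 else (i == j)%:R.
  by rewrite mxE; case: (i == k); rewrite ?andbF ?andbT.
suff [g hg] : exists g, linsub 1%:M f - linsub B f = 'X_k * g.
  by exists g; rewrite -hg addrC linsub1 subrK.
pose I (x : {mpoly K[n]}) := exists g, x = 'X_k * g.
apply: (@rmorph_congr _ _ I); rewrite /I.
- by exists 0; rewrite mulr0.
- by move=> a b [g ->] [h ->]; exists (g + h); rewrite mulrDr.
- by move=> a b [g ->]; exists (a * g); rewrite mulrCA.
- by move=> a b [g ->]; exists (g * b); rewrite mulrA.
- by move=> c; rewrite /= !linsubC.
move=> i; rewrite /= !linsubX.
have -> : \sum_i0 (1%:M : 'M_n) i0 i *: 'X_i0 = 'X_i :> {mpoly K[n]}.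
  by rewrite -linsubX linsub1.
case: (eqVneq i k) => [->|ne].
  exists 1; rewrite mulr1 big1 ?subr0 // => j _; rewrite hB.
  by case: (eqVneq j k) => _; rewrite scale0r.
exists 0; rewrite mulr0 (bigD1 i) //= hB (negPf ne) eqxx scale1r big1 ?addr0 ?subrr //.
by move=> j ji; rewrite hB (negPf ji); case: ifP => _; rewrite scale0r.
Qed.

End LinearSubstitution.

(** * Polynomials and binary forms vanishing everywhere *)

Section InfiniteField.
Variable K : numFieldType.

(** In characteristic 0 the integers below [size p] are distinct, and they would be too many
    roots. *)
Lemma poly_zero_everywhere (p : {poly K}) : (forall t, p.[t] = 0) -> p = 0.
Proof.
move=> p0; apply/eqP; apply: contraT => pn0.
have := max_poly_roots pn0 (rs := [seq k%:R | k <- iota 0 (size p)]).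
rewrite size_map size_iota ltnn; apply.
  by apply/allP => _ /mapP[k _ ->]; apply/rootP; apply: p0.
by rewrite map_inj_uniq ?iota_uniq // => i j /eqP; rewrite eqr_nat => /eqP.
Qed.

(** Dehomogenize at the points [(t, 1)]. In a fixed degree the exponent of ['X_0] determines the
    monomial, so no two coefficients of [h] merge in the resulting univariate polynomial. *)
Lemma binary_form_zero d (h : {mpoly K[2]}) : h \is d.-homog ->
  (forall v : 'rV[K]_2, v != 0 -> h.@[v 0] = 0) -> h = 0.
Proof.
move=> /dhomogP hh h0.
pose p : {poly K} := \sum_(m <- msupp h) h@_m *: 'X^(m 0).
have p0 : p = 0.
  apply: poly_zero_everywhere => t.
  pose v : 'rV[K]_2 := \row_i (if i == 0 then t else 1).
  have /h0 <- : v != 0.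
    by apply/eqP => /rowP/(_ 1); rewrite !mxE /= => /eqP; rewrite oner_eq0.
  rewrite mevalE horner_sum; apply: eq_bigr => m _.
  rewrite hornerZ hornerXn; congr (_ * _).
  by rewrite big_ord_recl big_ord1 !mxE /= expr1n mulr1.
apply/eqP; rewrite -msupp_eq0; case E: (msupp h) => [//|m s].
have mh : m \in msupp h by rewrite E mem_head.
have : p`_(m 0) = 0 by rewrite p0 coef0.
rewrite coef_sum (bigD1_seq m) //= ?msupp_uniq //.
rewrite coefZ coefXn eqxx mulr1 big_seq_cond big1 => [|m' /andP[m'h ne]].
  by rewrite addr0 => /eqP; rewrite mcoeff_eq0 mh.
rewrite coefZ coefXn; case: eqP => [e|_]; last by rewrite mulr0.
case/eqP: ne; apply/mnmP => i.
have: mdeg m = mdeg m' by rewrite (hh _ mh) (hh _ m'h).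
rewrite !mdegE !big_ord_recl !big_ord0 !addn0 /= -!/(0 : 'I_2).
have -> : lift ord0 ord0 = 1 :> 'I_2 by apply/val_inj.
have -> : ord0 = 0 :> 'I_2 by apply/val_inj.
rewrite -e => /addnI; case: (unliftP 0 i) => [j|] -> //=.
by rewrite ord1; have -> : lift 0 0 = 1 :> 'I_2 by apply/val_inj.
Qed.

End InfiniteField.

(** * Growth of quotients *)

Section Growth.
Variables (K : fieldType) (n : nat) (C : 'M[K]_(2, n)).
Local Notation S := {mpoly K[n]}.
Local Notation rho := (linsub C).

(** A substitute for the Hilbert function that makes sense for inhomogeneous ideals: [r] elements
    independent modulo [I] whose restrictions to the line have degree less than [d]. *)
Definition grows (I : S -> Prop) (d r : nat) : Prop :=
  exists u : 'I_r -> S, (forall i, (msize (rho (u i)) <= d)%N) /\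
    forall c : 'I_r -> K, I (\sum_i c i *: u i) -> forall i, c i = 0.

(** For ideals: [I'] contains [I + (f)], and [f] is a nonzerodivisor modulo [I]. Both a step of a
    regular sequence and a strict inclusion of primes have this form. *)
Definition cuts (f : S) (I I' : S -> Prop) : Prop :=
  (forall x g, I (x + f * g) -> I' x) /\ (forall g, I (f * g) -> I g).

(** Join the family for [I'] with [f] times the family for [I]. A relation modulo [I] holds modulo
    [I'] without its multiples of [f], so the first coefficients vanish; cancelling [f] then kills
    the others. *)
Lemma grows_cut f I I' d d' r r' : cuts f I I' ->
    grows I' d' r' -> grows I d r ->
  grows I (maxn d' (msize (rho f) + d).+1) (r' + r).
Proof.
move=> [fI' regf] [u [du iu]] [v [dv iv]].
exists (fun i => match split i with inl j => u j | inr j => f * v j end).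
split=> [i|c hc].
  case: split => j /=; first exact: leq_trans (du j) (leq_maxl _ _).
  apply: leq_trans (leq_maxr _ _); rewrite rmorphM.
  apply: leq_trans (msizeM_le _ _) _.
  by rewrite ltnS leq_add2l dv.
have {}hc : I (\sum_i c (lshift r i) *: u i +
    f * \sum_i c (rshift r' i) *: v i).
  move: hc; rewrite big_split_ord /=; congr I; congr (_ + _).
    apply: eq_bigr => i _; case: split_ordP => j; first by move/lshift_inj => ->.
    by move/eqP; rewrite eq_lrshift.
  rewrite mulr_sumr; apply: eq_bigr => i _.
  case: split_ordP => j; first by move/eqP; rewrite eq_rlshift.
  by move/rshift_inj => ->; rewrite scalerAr.
have hu := iu _ (fI' _ _ hc).
have hv : I (\sum_i c (rshift r' i) *: v i).
  apply: regf; move: hc; rewrite big1 ?add0r // => i _.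
  by rewrite (hu i) scale0r.
by move=> i; case: (split_ordP i) => j ->; [apply: hu|apply: (iv _ hv)].
Qed.

Lemma grows_le I d d' r : (d <= d')%N -> grows I d r -> grows I d' r.
Proof.
by move=> dd' [u [du iu]]; exists u; split=> // i; apply: leq_trans (du i) dd'.
Qed.

Lemma grows0 I d : grows I d 0.
Proof. by exists (fun=> 0); split=> [[]|c _ []]. Qed.

(** Restrictions of degree less than [d] involve only the [d * d] monomials with both exponents
    below [d]. A larger family has a linear relation among its restrictions, and this relation lies
    in the kernel of [rho], hence in [I]. *)
Lemma grows_bound I d r : (forall g, rho g = 0 -> I g) ->
  grows I d r -> (r <= d * d)%N.
Proof.
move=> kI [u [du iu]]; rewrite leqNgt; apply/negP => dr.
pose mon (a b : 'I_d) : 'X_{1..2} := [multinom (if i == 0%R then a : nat else b) | i < 2].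
pose A : 'M[K]_(r, d * d) :=
  \matrix_i mxvec (\matrix_(a < d, b < d) (rho (u i))@_(mon a b)).
have kA : kermx A != 0.
  rewrite kermx_eq0 /row_free neq_ltn (leq_ltn_trans (rank_leq_col A)) //.
have [i ki] : exists i, row i (kermx A) != 0.
  apply/existsP; apply: contraNT kA => /existsPn h; apply/eqP/row_matrixP => i.
  by have := h i; rewrite negbK row0 => /eqP.
case/eqP: ki; apply/rowP => j; rewrite mxE [RHS]mxE.
apply: (iu (fun j => kermx A i j)); apply: kI.
set c := row i (kermx A).
have cA : c *m A = 0 by rewrite /c -row_mul mulmx_ker row0.
rewrite raddf_sum; apply/mpolyP => m; rewrite mcoeff0 raddf_sum /=.
case: (leqP d (mdeg m)) => md.
  rewrite big1 // => k _; rewrite linearZ mcoeffZ /= (memN_msupp_eq0 _) ?mulr0 //.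
  exact/msize_mdeg_ge/(leq_trans (du k)).
have md2 : mdeg m = (m 0%R + m 1%R)%N.
  by rewrite mdegE big_ord_recl big_ord1; congr (_ + m _)%N; apply: val_inj.
have m0 : (m 0%R < d)%N by lia.
have m1 : (m 1%R < d)%N by lia.
have -> : m = mon (Ordinal m0) (Ordinal m1).
  apply/mnmP => k; rewrite mnmE; case: (eqVneq k 0) => [->//|k0] /=.
  by congr (m _); case: (unliftP 0 k) k0 => [l -> _|->//]; rewrite ord1; apply: val_inj.
move/rowP/(_ (mxvec_index (Ordinal m0) (Ordinal m1))): cA.
rewrite mxE [RHS]mxE; apply: etrans.
apply: eq_bigr => k _.
have -> : c 0 k = kermx A i k by rewrite mxE.
by rewrite [A k _]mxE mxvecE [in RHS]mxE linearZ mcoeffZ.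
Qed.

(* The quotients by [I3, I2, I1, I0] contain at least 1, then linearly,
   quadratically and cubically many independent elements of bounded degree,
   whereas the quotient of a line grows quadratically. *)
Lemma no_three_cuts (I0 I1 I2 I3 : S -> Prop) (f0 f1 f2 : S) :
    (forall g, rho g = 0 -> I0 g) ->
    cuts f0 I0 I1 -> cuts f1 I1 I2 -> cuts f2 I2 I3 ->
  (forall c, I3 c%:MP -> c = 0) -> False.
Proof.
move=> kI c0 c1 c2 I31.
(* Multiplication by any of the three cutting elements raises the size of a restriction by less than
   [e]. *)
pose e := (msize (rho f0) + msize (rho f1) + msize (rho f2)).+1.
have g3 : grows I3 1 1.
  exists (fun=> 1); split=> [_|c hc i]; first by rewrite rmorph1 msize1.
  apply: I31; move: hc; rewrite big_ord1 (ord1 i); congr (I3 _).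
  by rewrite -mul_mpolyC mulr1.
have g2 k : grows I2 (e * k) k.
  elim: k => [|k IH]; first exact: grows0.
  have := grows_cut c2 g3 IH; rewrite add1n; apply: grows_le; rewrite /e; nia.
have g1 k : grows I1 (e * k) 'C(k.+1, 2).
  elim: k => [|k IH]; first exact: grows0.
  have -> : 'C(k.+2, 2) = (k.+1 + 'C(k.+1, 2))%N by rewrite binS bin1 addnC.
  by apply: grows_le (grows_cut c1 (g2 k.+1) IH); rewrite /e; nia.
have g0 k : grows I0 (e * k) 'C(k.+2, 3).
  elim: k => [|k IH]; first exact: grows0.
  have -> : 'C(k.+3, 3) = ('C(k.+2, 2) + 'C(k.+2, 3))%N by rewrite binS addnC.
  by apply: grows_le (grows_cut c0 (g1 k.+1) IH); rewrite /e; nia.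
(* The binomial ['C(k.+2, 3)] exceeds [k^3 / 6], which equals the bound [(e k)^2] at [k = 6 e^2]. *)
have := grows_bound kI (g0 (6 * e * e)%N); rewrite leqNgt => /negP; apply.
have : (0 < e)%N by [].
move: (e) => m m_gt0; rewrite -(ltn_pmul2r (m := 3 `!)) // bin_ffact.
by rewrite !ffactnS ffactn0 !factS fact0 /=; nia.
Qed.

End Growth.

(** * Ideals of lines *)

(** A left inverse makes the columns of [G] independent, so they extend to a basis: in the rank
    factorization of [G], the factor [row_ebase G] is completed by an identity block. *)
Lemma extend_unitmx (K : fieldType) p N (C : 'M[K]_(p, N)) (G : 'M[K]_(N, p)) :
    C *m G = 1%:M ->
  exists2 Q : 'M[K]_N, Q \in unitmx &
    forall i (j : 'I_p) (k : 'I_N), j = k :> nat -> Q i k = G i j.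
Proof.
move=> CG; have rG : \rank G = p.
  apply/eqP; rewrite eqn_leq rank_leq_col /= -{1}(mxrank1 K p) -CG.
  exact: mxrankM_maxr.
have pN : (p <= N)%N by rewrite -rG rank_leq_row.
have [q Nq] : exists q, N = (p + q)%N by exists (N - p)%N; lia.
subst N; pose R : 'M[K]_(p + q) := block_mx (row_ebase G) 0 0 1%:M.
exists (col_ebase G *m R).
  rewrite unitmx_mul col_ebase_unit unitmxE det_ublock det1 mulr1 -unitmxE.
  exact: row_ebase_unit.
move=> i j k jk; have -> : k = lshift q j by apply: val_inj.
rewrite -[in RHS](mulmx_ebase G) rG -mulmxA !mxE; apply: eq_bigr => l _.
congr (_ * _); rewrite -[l]splitK; case: (split l) => m /=.
  rewrite block_mxEul mxE (bigD1 m) //= mxE /= eqxx ltn_ord mul1r big1 ?addr0 //.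
  by move=> m' m'm; rewrite mxE /= eq_sym (inj_eq val_inj) (negPf m'm) mul0r.
rewrite block_mxEdl mxE [RHS]mxE big1 // => m' _.
by rewrite mxE /= [(_ < p)%N]ltnNge leq_addr andbF mul0r.
Qed.

Section LineIdeal.
Variables (K : numFieldType) (n : nat).
Local Notation S := {mpoly K[n.+1]}.
Implicit Types l : line K n.

(** A parametrization of the line: [linsub (line_mx l)] is restriction to [l]. *)
Definition line_mx l : 'M[K]_(2, n.+1) := \matrix_(i < 2) (vbasis (cone l))`_i.

Lemma line_mx_sum l (a : 'rV[K]_2) :
  a *m line_mx l = \sum_i a 0 i *: (vbasis (cone l))`_i.
Proof. by rewrite mulmx_sum_row; apply: eq_bigr => i _; rewrite rowK. Qed.

Lemma line_mxP l (a : 'rV[K]_2) : a *m line_mx l \in cone l.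
Proof.
rewrite line_mx_sum memv_suml // => i _; rewrite memvZ // vbasis_mem //.
by rewrite mem_nth // size_tuple (eqP (dim_cone l)).
Qed.

Lemma cone_line_mx l v : v \in cone l -> exists a, v = a *m line_mx l.
Proof.
move=> /coord_vbasis; have e := eqP (dim_cone l); set b := coord _ => ->.
exists (\row_i b (cast_ord (esym e) i) v).
rewrite line_mx_sum (reindex (cast_ord (esym e))) /=.
  by apply: eq_bigr => i _; rewrite mxE.
by exists (cast_ord e) => i _; rewrite ?cast_ordK ?cast_ordKV.
Qed.

Lemma line_mx_free l : row_free (line_mx l).
Proof.
apply: inj_row_free => a; rewrite line_mx_sum => a0.
have e := eqP (dim_cone l).
have /freeP fr := basis_free (vbasisP (cone l)).
apply/rowP => i; rewrite mxE -(cast_ordKV e i).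
apply: (fr (fun j => a 0 (cast_ord e j))).
rewrite -[RHS]a0 (reindex (cast_ord (esym e))) /=.
  by apply: eq_bigr => j _; rewrite cast_ordKV.
by exists (cast_ord e) => j _; rewrite ?cast_ordK ?cast_ordKV.
Qed.

Lemma line_mx_inv l : exists G, line_mx l *m G = 1%:M.
Proof. by have /row_freeP := line_mx_free l. Qed.

Lemma mul_line_mx_eq0 l p (a : 'M[K]_(p, 2)) : a *m line_mx l = 0 -> a = 0.
Proof.
by have [G CG] := line_mx_inv l => a0; rewrite -[a]mulmx1 -CG mulmxA a0 mul0mx.
Qed.

(** A form vanishing on the line restricts to a binary form vanishing at every nonzero point, hence
    to 0. Conversely, the kernel of restriction is generated by linear forms, and these vanish on
    the line. *)
Lemma line_idealP l (f : S) : line_ideal l f <-> linsub (line_mx l) f = 0.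
Proof.
split=> [[s [hs ->]]|].
  rewrite raddf_sum big_seq big1 // => p /hs[[d hd] hv] /=.
  rewrite rmorphM /=; suff -> : linsub (line_mx l) p.2 = 0 by rewrite mulr0.
  apply: binary_form_zero (linsub_homog _ hd) _ => v v0.
  rewrite meval_linsub; apply: hv; first exact: line_mxP.
  by apply: contra v0 => /eqP/mul_line_mx_eq0 ->.
have [G CG] := line_mx_inv l; move=> /(linsub_kernel CG)[s [hs ->]].
exists s; split=> // p /hs [hp p0]; split; first by exists 1%N.
by move=> v /cone_line_mx[a ->] _; rewrite -meval_linsub p0 meval0.
Qed.

Definition disjoint_lines l l' : Prop := (cone l :&: cone l' = 0)%VS.

(** The four basis vectors are independent, so the stacked matrix has a right inverse, whose two
    column blocks are [G1] and [G2]. *)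
Lemma disjoint_line_mx_free l l' : disjoint_lines l l' ->
  exists G1 G2 : 'M[K]_(n.+1, 2),
    [/\ line_mx l *m G1 = 1%:M, line_mx l' *m G1 = 0,
        line_mx l *m G2 = 0 & line_mx l' *m G2 = 1%:M].
Proof.
move=> d; have /row_freeP[G] : row_free (col_mx (line_mx l) (line_mx l')).
  apply: inj_row_free => v; rewrite -[v]hsubmxK mul_row_col => v0.
  have e : lsubmx v *m line_mx l = - rsubmx v *m line_mx l'.
    by rewrite mulNmx; apply/eqP; rewrite -addr_eq0 v0.
  have : lsubmx v *m line_mx l \in (cone l :&: cone l')%VS.
    by rewrite memv_cap line_mxP e line_mxP.
  rewrite d memv0 => /eqP l0; move: e; rewrite l0 => /esym/eqP.
  rewrite mulNmx oppr_eq0 => /eqP r0.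
  have -> : lsubmx v = 0 by exact: mul_line_mx_eq0 l0.
  have -> : rsubmx v = 0 by exact: mul_line_mx_eq0 r0.
  by rewrite row_mx0.
rewrite -[G]hsubmxK mul_col_row scalar_mx_block => /eq_block_mx[h1 h2 h3 h4].
by exists (lsubmx G), (rsubmx G).
Qed.

(** The ideals of two disjoint lines add up to the maximal ideal: [q] is the pullback of [a] along
    the map [G1 *m line_mx l], which is the identity on [l] and 0 on [l']. *)
Lemma disjoint_split l l' (a : S) : disjoint_lines l l' -> a@_0 = 0 ->
  exists q, linsub (line_mx l) (a - q) = 0 /\ linsub (line_mx l') q = 0.
Proof.
move=> /disjoint_line_mx_free[G1 [G2 [h1 h2 _ _]]] a0.
exists (linsub (G1 *m line_mx l) a).
by rewrite raddfB /= !linsub_comp !mulmxA h1 h2 mul1mx mul0mx linsub0 a0 subrr.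
Qed.

Variable M : {fset (line K n)}.
Hypothesis M_gen : general_linear_position M.
Hypothesis n_ge3 : (3 <= n)%N.

(** As [n >= 3], two of the lines span a projective 3-space; the cones then have a 4-dimensional sum
    and meet in 0. *)
Lemma general_disjoint l l' : l \in M -> l' \in M -> l' != l ->
  disjoint_lines l l'.
Proof.
move=> lM l'M ne; pose A := (l |` [fset l'])%fset.
have lA : l \notin [fset l']%fset by rewrite in_fset1 eq_sym.
have AM : (A `<=` M)%fset.
  by apply/fsubsetP => x; rewrite in_fset1U in_fset1 => /orP[]/eqP ->.
have A0 : A != fset0 by apply/fset0Pn; exists l; rewrite in_fset1U eqxx.
have := M_gen AM A0; rewrite /proj_dim big_fsetU1 //= big_seq_fset1.
rewrite cardfsU1 lA cardfs1 (minn_idPl _) //= => dimA.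
have := dimv_sum_cap (cone l) (cone l').
rewrite (eqP (dim_cone l)) (eqP (dim_cone l')) -[(_ + _)%N in RHS]/4%N.
have -> : \dim (cone l + cone l') = 4 by move: dimA; case: (\dim _) => //= k ->.
by move/eqP; rewrite -[X in _ == X]addn0 eqn_add2l dimv_eq0 => /eqP.
Qed.

Definition lines_ideal (f : S) : Prop := forall l, l \in M -> linsub (line_mx l) f = 0.

Lemma linsub_section_neq0 l l' : disjoint_lines l l' ->
  exists g : S, linsub (line_mx l) g != 0 /\ linsub (line_mx l') g = 0.
Proof.
move=> /disjoint_line_mx_free[G1 [G2 [h1 h2 _ _]]].
exists (linsub G1 'X_0); rewrite !linsub_comp h1 h2 linsub1 linsub0.
rewrite mcoeffX mnm1_eq0 mpolyC0; split=> //.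
by rewrite -msize_poly_eq0 msizeX mdeg1.
Qed.

(** If [a] vanished on [l], multiply polynomials that vanish on each of the other lines but not on
    [l]. Then [a] times the product lies in the ideal of all the lines while the product does
    not. *)
Lemma regular_not_in_line (a : S) :
  (forall g, lines_ideal (a * g) -> lines_ideal g) ->
  forall l, l \in M -> linsub (line_mx l) a != 0.
Proof.
move=> rega l lM; apply/eqP => a0.
have prod (s : seq (line K n)) : {subset s <= (M `\ l)%fset} ->
    exists g, linsub (line_mx l) g != 0 /\
      forall l', l' \in s -> linsub (line_mx l') g = 0.
  elim: s => [|l' s IH] sM; first by exists 1; rewrite rmorph1 oner_neq0.
  have sM' : {subset s <= (M `\ l)%fset}.
    by move=> x xs; apply: sM; rewrite in_cons xs orbT.
  have [g [gl gs]] := IH sM'.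
  have /andP[ne l'M] : (l' != l) && (l' \in M).
    by rewrite -in_fsetD1; apply: sM; rewrite mem_head.
  have [h [hl hl']] := linsub_section_neq0 (general_disjoint lM l'M ne).
  exists (g * h); split=> [|x]; first by rewrite rmorphM mulf_neq0.
  by rewrite in_cons rmorphM /= => /orP[/eqP ->|/gs ->]; rewrite ?hl' ?mulr0 ?mul0r.
have [g [gl gM]] := prod (enum_fset (M `\ l)%fset) (fun _ => id).
have : lines_ideal g.
  apply: rega => l' l'M; rewrite rmorphM /=; case: (eqVneq l' l) => [->|ne].
    by rewrite a0 mul0r.
  by rewrite gM ?mulr0 // in_fsetD1 ne.
by move=> /(_ l lM)/eqP; rewrite (negPf gl).
Qed.

(** Take [c = (1, t, t^2, ...)]: the value [v *m c] is the polynomial with coefficients [v] at [t],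
    and the product of these nonzero polynomials is nonzero at some [t]. *)
Lemma avoid_zeros (vs : seq 'rV[K]_n.+1) : all (fun v => v != 0) vs ->
  exists c : 'cV[K]_n.+1, all (fun v => v *m c != 0) vs.
Proof.
move=> vs0; pose P := \prod_(v <- vs) rVpoly v.
have P0 : P != 0.
  rewrite prodf_seq_neq0; apply/allP => v /(allP vs0) v0 /=.
  by apply: contra v0 => /eqP v0; rewrite -[v]rVpolyK v0 raddf0.
have [t Pt] : exists t, P.[t] != 0.
  apply: contrapT => h; case/eqP: P0; apply: poly_zero_everywhere => t.
  by apply/eqP; apply: contraT => ht; case: h; exists t.
exists (\col_i t ^+ i); apply/allP => v vvs; move: Pt.
rewrite /P (big_rem v) //= hornerM mulf_eq0 negb_or => /andP[vt _].
apply: contra vt => /eqP/matrixP/(_ 0 0); rewrite !mxE => <-.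
rewrite horner_poly; apply/eqP/eq_bigr => i _; rewrite mxE.
by rewrite insubT //= => lti; congr (v 0 _ * _); apply: val_inj.
Qed.

(* Multiply 1 successively by the highest power of each element of [s] that
   does not bring the product into [I]. *)
Lemma annihilated_outside (A : comNzRingType) (I : A -> Prop) (s : seq A) :
    (forall a b, I b -> I (a * b)) -> ~ I 1 ->
    (forall a, a \in s -> exists k, I (a ^+ k)) ->
  exists z, ~ I z /\ forall a, a \in s -> I (a * z).
Proof.
move=> IM I1; elim: s => [|a s IH] nil; first by exists 1.
have [|z [zI sz]] := IH; first by move=> b bs; apply: nil; rewrite inE bs orbT.
have [k hk] := nil a (mem_head _ _).
have ex : exists k, `[< I (a ^+ k * z) >].
  by exists k; apply/asboolP; rewrite mulrC; apply: IM.
case: (ex_minnP ex) => -[|m] /asboolP hm minm; first by case: zI; rewrite -[z]mul1r.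
exists (a ^+ m * z); split=> [hz|b].
  by have := minm m; rewrite ltnn => /(_ (introT (asboolP _) hz)).
rewrite inE => /orP[/eqP ->|bs]; first by rewrite mulrA -exprS.
by rewrite mulrCA; apply/IM/sz.
Qed.

End LineIdeal.

(** * Socles and the coordinate ring *)

Lemma linsub_mcoeff0 (K : fieldType) p q (C : 'M[K]_(p, q)) f :
  (linsub C f)@_0 = f@_0.
Proof.
have := linsub_comp (0 : 'M_(p, p)) C f; rewrite mul0mx !linsub0.
by move=> /(congr1 (mcoeff 0)); rewrite !mcoeffC eqxx !mulr1.
Qed.

Lemma mcoeff0M (K : fieldType) n (f g : {mpoly K[n]}) :
  (f * g)@_0 = f@_0 * g@_0.
Proof. exact: rmorphM. Qed.

(** A polynomial minus its constant term is the difference of the identity and the zero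
    substitution, which on each variable is that variable. *)
Lemma max_homog_idealP (K : fieldType) n (f : {mpoly K[n]}) :
  max_homog_ideal f <-> f@_0 = 0.
Proof.
split=> [[s [hs ->]]|f0].
  rewrite raddf_sum big_seq big1 // => p /hs[i ->] /=.
  by rewrite mcoeff0M mcoeffX mnm1_eq0 mulr0.
suff : max_homog_ideal (linsub 1%:M f - linsub (0 : 'M_n) f).
  by rewrite linsub1 linsub0 f0 mpolyC0 subr0.
apply: rmorph_congr.
- exact: in_ideal_gen0.
- exact: in_ideal_genD.
- exact: in_ideal_genMl.
- by move=> a b Ia; rewrite mulrC; apply: in_ideal_genMl.
- by move=> c; rewrite /= !linsubC.
move=> i; apply: in_ideal_gen_mem; exists i.
by rewrite /= linsub1 linsub0 mcoeffX mnm1_eq0 mpolyC0 subr0.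
Qed.

Section Socle.
Variables (K : numFieldType) (n : nat) (M : {fset (line K n)}).
Local Notation S := {mpoly K[n.+1]}.
Hypothesis M_gen : general_linear_position M.
Hypothesis n_ge3 : (3 <= n)%N.
Variables (l1 l2 : line K n).
Hypotheses (l1M : l1 \in M) (l2M : l2 \in M) (l21 : l2 != l1).

(* The sum of the ideal of [l1] and of the ideal of the other lines. *)
Let sum_ideal (f : S) : Prop :=
  exists q, linsub (line_mx l1) (f - q) = 0 /\
    forall l, l \in M -> l != l1 -> linsub (line_mx l) q = 0.

Let sum_idealM a b : sum_ideal b -> sum_ideal (a * b).
Proof.
move=> [q [q1 qM]]; exists (a * q); split=> [|l lM ll1].
  by rewrite -mulrBr rmorphM /= q1 mulr0.
by rewrite rmorphM /= qM // mulr0.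
Qed.

Let sum_ideal1 : ~ sum_ideal 1.
Proof.
move=> [q [q1 /(_ l2 l2M l21) q2]].
have := linsub_mcoeff0 (line_mx l1) (1 - q); rewrite q1 mcoeffB mcoeff0.
rewrite -(linsub_mcoeff0 (line_mx l2) q) q2 mcoeff0 subr0 mcoeff1 eqxx.
by move/eqP; rewrite eq_sym oner_eq0.
Qed.

(** Modulo the ideal of [l1], [a] is congruent to an element of the ideal of each other line.
    Multiplying these congruences makes a power of [a] congruent to an element of the ideal of all
    the others. *)
Let sum_ideal_nil (a : S) : a@_0 = 0 -> exists k, sum_ideal (a ^+ k).
Proof.
move=> a0.
suff nil (s : seq (line K n)) : {subset s <= (M `\ l1)%fset} ->
    exists k q, linsub (line_mx l1) (a ^+ k - q) = 0 /\
      forall l, l \in s -> linsub (line_mx l) q = 0.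
  have [k [q [q1 qM]]] := nil (enum_fset (M `\ l1)%fset) (fun _ => id).
  exists k, q; split=> // l lM ll1; apply: qM.
  by rewrite -[_ \in _]/(l \in (M `\ l1)%fset) in_fsetD1 ll1.
elim: s => [|l s IH] sM.
  by exists 0%N, 1; split=> //; rewrite expr0 subrr raddf0.
have sM' : {subset s <= (M `\ l1)%fset}.
  by move=> x xs; apply: sM; rewrite in_cons xs orbT.
have [k [q [q1 qs]]] := IH sM'.
have /andP[ne lM] : (l != l1) && (l \in M).
  by rewrite -in_fsetD1; apply: sM; rewrite mem_head.
have [p [p1 pl]] := disjoint_split (general_disjoint M_gen n_ge3 l1M lM ne) a0.
exists k.+1, (q * p); split=> [|x].
  have -> : a ^+ k.+1 - q * p = (a ^+ k - q) * p + a ^+ k * (a - p).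
    by rewrite exprSr; ring.
  by rewrite raddfD /= !rmorphM /= q1 p1 mul0r mulr0 addr0.
by rewrite in_cons rmorphM /= => /orP[/eqP ->|/qs ->]; rewrite ?pl ?mulr0 ?mul0r.
Qed.

(* Multiplication by [a] on both factors embeds the socle of [S / sum_ideal]
   in [S / (J + (a))], where [J] is the ideal of all the lines: if
   [a z = p + x] with [p] vanishing on [l1] and [x] on the other lines, the
   class of [z] is sent to that of [x]. *)
Lemma socle_mod_nonzerodivisor (a : S) (s : seq S) :
    (forall l, l \in M -> linsub (line_mx l) a != 0) -> a@_0 = 0 ->
    (forall b, b \in s -> b@_0 = 0) ->
  exists x, ~ (exists c, lines_ideal M (x - a * c)) /\
    forall b, b \in s -> exists y, lines_ideal M (b * x - a * y).
Proof.
move=> rega a0 s0.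
have [b|z [zI zs]] := @annihilated_outside S sum_ideal (a :: s) sum_idealM sum_ideal1.
  by rewrite in_cons => /orP[/eqP ->|/s0]; [exact: sum_ideal_nil | exact: sum_ideal_nil].
have [x [x1 xM]] := zs a (mem_head _ _).
exists x; split=> [[c hc]|b bs].
  (* If [x = a c] modulo the ideal of all the lines, cancelling [a] on each line shows that [z - c]
     vanishes on [l1] and [c] on the others, so [z] would lie in [sum_ideal]. *)
  apply: zI; exists c; split=> [|l lM ll1].
    have : linsub (line_mx l1) (a * (z - c)) = 0.
      have -> : a * (z - c) = (a * z - x) + (x - a * c) by ring.
      by rewrite raddfD /= x1 hc // addr0.
    by move/eqP; rewrite rmorphM mulf_eq0 /= (negPf (rega _ l1M)) => /eqP.
  move/eqP: (hc l lM); rewrite raddfB /= xM // sub0r oppr_eq0 rmorphM mulf_eq0 /=.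
  by rewrite (negPf (rega _ lM)) => /eqP.
have [|y [y1 yM]] := zs b; first by rewrite in_cons bs orbT.
exists y => l lM; case: (eqVneq l l1) => [->|ll1].
  have -> : b * x - a * y = a * (b * z - y) - b * (a * z - x).
    by ring.
  by rewrite raddfB /= !rmorphM /= y1 x1 !mulr0 subrr.
by rewrite raddfB /= !rmorphM /= xM // yM // !mulr0 subrr.
Qed.

End Socle.

Section CoordinateRing.
Variables (K : numFieldType) (n : nat) (M : line_collection K n).
Local Notation S := {mpoly K[n.+1]}.
Local Notation pi := (coord_ring_pi M).
Local Notation J := (lines_ideal M).

Lemma lines_idealP f : (f \in defining_ideal M) <-> J f.
Proof.
split=> [/asboolP h l lM|h]; first by apply/line_idealP/h.
by apply/asboolP => l lM; apply/line_idealP/h.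
Qed.

Lemma coord_ring_pi_eq0 f : pi f = 0 <-> J f.
Proof.
rewrite -lines_idealP /coord_ring_pi.
have -> : (0 : coord_ring M) = (\pi_({ideal_quot (defining_ideal M)}) 0)%qT.
  by rewrite rmorph0.
split=> [/eqP|h]; first by rewrite -Quotient.idealrBE subr0.
by apply/eqP; rewrite -Quotient.idealrBE subr0.
Qed.

Lemma coord_ring_pi_surj x : exists f, x = pi f.
Proof. by exists (repr x); rewrite /coord_ring_pi reprK. Qed.

Lemma coord_ring_piB f g : pi (f - g) = pi f - pi g.
Proof. exact: rmorphB. Qed.

Lemma coord_ring_piD f g : pi (f + g) = pi f + pi g.
Proof. exact: rmorphD. Qed.

Lemma coord_ring_piM f g : pi (f * g) = pi f * pi g.
Proof. exact: rmorphM. Qed.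

Lemma coord_ring_pi1 : pi 1 = 1.
Proof. exact: rmorph1. Qed.

Lemma coord_ring_scaleE (a : S) f : a *: pi f = pi (a * f).
Proof. by rewrite coord_ring_piM. Qed.

Lemma coord_ring_pi_sum I (r : seq I) (F : I -> S) :
  pi (\sum_(i <- r) F i) = \sum_(i <- r) pi (F i).
Proof. exact: rmorph_sum. Qed.

Lemma in_seq_mul_pi (s : seq S) f : in_seq_mul s (pi f) <->
  exists y : 'I_(size s) -> S, J (f - \sum_(i < size s) s`_i * y i).
Proof.
split=> [[y hy]|[y hy]].
  have [g hg] := choice (fun i => coord_ring_pi_surj (y i)).
  exists g; apply/coord_ring_pi_eq0; rewrite coord_ring_piB hy coord_ring_pi_sum.
  apply/eqP; rewrite subr_eq0; apply/eqP/eq_bigr => i _.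
  by rewrite -coord_ring_scaleE hg.
exists (fun i => pi (y i)); apply/eqP; rewrite -subr_eq0; apply/eqP.
move/coord_ring_pi_eq0: hy; rewrite coord_ring_piB coord_ring_pi_sum.
by apply: etrans; congr (_ - _); apply: eq_bigr => i _; rewrite coord_ring_scaleE.
Qed.

Lemma in_seq_mul0 f : in_seq_mul [::] (pi f) <-> J f.
Proof.
rewrite in_seq_mul_pi; split=> [[y]|h]; first by rewrite big_ord0 subr0.
by exists (fun=> 0); rewrite big_ord0 subr0.
Qed.

Lemma in_seq_mul1 a f : in_seq_mul [:: a] (pi f) <-> exists c, J (f - a * c).
Proof.
rewrite in_seq_mul_pi; split=> [[y]|[c h]].
  by rewrite big_ord1; exists (y ord0).
by exists (fun=> c); rewrite big_ord1.
Qed.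

Lemma lines_ideal_mcoeff0 f : J f -> f@_0 = 0.
Proof.
have [l lM] := fset0Pn _ (lines_neq0 M).
by move=> /(_ l lM) h; rewrite -(linsub_mcoeff0 (line_mx l)) h mcoeff0.
Qed.

End CoordinateRing.

(** * Depth and Krull dimension *)

(** Coefficients indexed by [nat] need no cast when the sequence grows. *)
Lemma in_seq_mul_nat (A : comNzRingType) (V : lmodType A) (s : seq A) (x : V) :
  in_seq_mul s x <->
  exists y : nat -> V, x = \sum_(i < size s) s`_i *: y i.
Proof.
split=> [[y ->]|[y ->]]; last by exists (fun i => y i).
exists (fun k => if insub k is Some i then y i else 0).
by apply: eq_bigr => i _; rewrite valK.
Qed.

Lemma in_seq_mul_rcons (A : comNzRingType) (V : lmodType A) (s : seq A) a
    (x z : V) :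
  in_seq_mul s (x + a *: z) -> in_seq_mul (rcons s a) x.
Proof.
move=> /in_seq_mul_nat[y hy]; apply/in_seq_mul_nat.
exists (fun i => if (i < size s)%N then y i else - z).
rewrite size_rcons big_ord_recr /= ltnn nth_rcons ltnn eqxx scalerN.
apply/eqP; rewrite eq_sym subr_eq hy; apply/eqP/eq_bigr => i _.
by rewrite ltn_ord nth_rcons ltn_ord.
Qed.

Lemma linsubX_eq0 (K : fieldType) p q (A : 'M[K]_(p, q)) j i :
  linsub A 'X_j = 0 -> A i j = 0.
Proof.
move=> /(congr1 (mcoeff U_(i))); rewrite linsubX mcoeff0 raddf_sum (bigD1 i) //=.
rewrite mcoeffZ mcoeffXU eqxx mulr1 big1 ?addr0 // => k ki.
by rewrite mcoeffZ mcoeffXU (negPf ki) mulr0.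
Qed.

Lemma mpolyX_neq0 (K : fieldType) n (i : 'I_n) : 'X_i != 0 :> {mpoly K[n]}.
Proof. by rewrite -msize_poly_eq0 msizeX. Qed.

Section Dimension.
Variables (K : numFieldType) (n : nat) (M : line_collection K n).
Local Notation S := {mpoly K[n.+1]}.
Local Notation pi := (coord_ring_pi M).
Local Notation J := (lines_ideal M).

Lemma in_seq_mul_mcoeff0 (s : seq S) f :
    (forall a, a \in s -> max_homog_ideal a) -> in_seq_mul s (pi f) -> f@_0 = 0.
Proof.
move=> sm /in_seq_mul_pi[y /lines_ideal_mcoeff0].
rewrite mcoeffB [X in _ - X]raddf_sum big1 ?subr0 // => i _ /=.
by rewrite mcoeff0M (max_homog_idealP _).1 ?mul0r //; apply/sm/mem_nth.
Qed.

Lemma in_seq_mul_proper (s : seq S) :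
    (forall a, a \in s -> max_homog_ideal a) ->
  ~ (forall x : coord_ring M, in_seq_mul s x).
Proof.
move=> sm /(_ (pi 1))/in_seq_mul_mcoeff0-/(_ sm)/eqP.
by rewrite mcoeff1 eqxx oner_eq0.
Qed.

(** It suffices that the form be nonzero at one chosen point of each line, here the first basis
    vector of its cone. *)
Lemma exists_nonvanishing_form : exists c : 'cV[K]_n.+1,
  forall l, l \in (M : {fset line K n}) -> linsub (line_mx l) (linsub c 'X_0) != 0.
Proof.
have [|c hc] := @avoid_zeros K n [seq row 0 (line_mx l) | l <- (M : {fset line K n})].
  apply/allP => _ /mapP[l lM ->]; apply/eqP => r0.
  have /mul_line_mx_eq0/rowP/(_ 0) : delta_mx (0 : 'I_1) 0 *m line_mx l = 0.
    by rewrite -rowE.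
  by rewrite !mxE eqxx => /eqP; rewrite oner_eq0.
exists c => l lM; have := allP hc _ (map_f _ lM).
apply: contra => /eqP; rewrite linsub_comp => h.
apply/eqP/matrixP => i j; rewrite -row_mul mxE [RHS]mxE ord1.
exact: linsubX_eq0 h.
Qed.

Lemma linform_max p (c : 'M[K]_(n.+1, p)) (j : 'I_p) :
  max_homog_ideal (linsub c 'X_j).
Proof. by apply/max_homog_idealP; rewrite linsub_mcoeff0 mcoeffX mnm1_eq0. Qed.

Lemma line_regular (l : line K n) a f : linsub (line_mx l) a != 0 ->
  linsub (line_mx l) (a * f) = 0 -> linsub (line_mx l) f = 0.
Proof. by move=> /negPf a0 /eqP; rewrite rmorphM mulf_eq0 /= a0 => /eqP. Qed.

Lemma depth_many : (3 <= n)%N -> general_linear_position M -> (2 <= #|` M|)%N ->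
  has_coord_depth M 1.
Proof.
move=> n_ge3 M_gen M2.
have [l1 l1M] := fset0Pn _ (lines_neq0 M).
have [l2] : exists l2, l2 \in ((M : {fset line K n}) `\ l1)%fset.
  apply/fset0Pn; rewrite -cardfs_gt0.
  by have := cardfsD1 l1 M; rewrite l1M => e; move: M2; rewrite e.
rewrite in_fsetD1 => /andP[l21 l2M].
split.
  have [c hc] := exists_nonvanishing_form.
  exists [:: linsub c 'X_0]; split=> //; split=> [a|].
    by rewrite mem_seq1 => /eqP ->; exact: linform_max.
  split=> [[|//] _ x|].
    have [f ->] := coord_ring_pi_surj x; rewrite coord_ring_scaleE /=.
    move=> /in_seq_mul0 h; apply/in_seq_mul0 => l lM.
    exact: line_regular (hc _ lM) (h _ lM).
  apply: in_seq_mul_proper => a; rewrite mem_seq1 => /eqP ->.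
  exact: linform_max.
move=> [|a [|b s]] // [sm [reg _]].
have am : a@_0 = 0 by apply/max_homog_idealP/sm; rewrite mem_head.
have bm : b@_0 = 0 by apply/max_homog_idealP/sm; rewrite !in_cons eqxx orbT.
have rega g : J (a * g) -> J g.
  move=> h; have := reg 0%N isT (pi g); rewrite coord_ring_scaleE /=.
  by rewrite !in_seq_mul0 => /(_ h).
have [|x [xa xb]] := @socle_mod_nonzerodivisor K n M M_gen n_ge3 l1 l2 l1M l2M l21 a
  [:: b] (regular_not_in_line M_gen n_ge3 rega) am.
  by move=> b'; rewrite mem_seq1 => /eqP ->.
(* The socle element [x] is killed by [b] modulo [a], so regularity of [b] would force [x] into
   [a R]. *)
case: xa; apply/in_seq_mul1; apply: (reg 1%N isT).
by rewrite coord_ring_scaleE; apply/in_seq_mul1/xb/mem_head.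
Qed.

(** Setting ['X_0] to 0 shows that [a] becomes 0, so [a] is a multiple of ['X_0]. This is the
    regularity of ['X_1] modulo ['X_0]. *)
Lemma mulX_exchange (a b : {mpoly K[2]}) : 'X_1 * a = 'X_0 * b ->
  exists g, a = 'X_0 * g.
Proof.
move=> e; have [g ag] := mulX_of_kill (0 : 'I_2) a; exists g.
move: ag; set B := \matrix_(i, j) _ => ag.
have B1 : linsub B 'X_1 = 'X_1.
  rewrite linsubX big_ord_recl big_ord1 !mxE /= scale0r add0r scale1r.
  by congr 'X_ _; apply: val_inj.
have B0 : linsub B 'X_0 = 0.
  by rewrite linsubX big_ord_recl big_ord1 !mxE /= !scale0r addr0.
have /eqP := congr1 (linsub B) e.
rewrite !rmorphM /= B1 B0 mul0r mulf_eq0 (negPf (mpolyX_neq0 _ _)) => /eqP a0.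
by rewrite {1}ag a0 add0r.
Qed.

Lemma lines_ideal_single l : (M : {fset line K n}) = [fset l]%fset ->
  forall f, J f <-> linsub (line_mx l) f = 0.
Proof.
move=> Ml f; rewrite /lines_ideal Ml; split=> [|h l']; last first.
  by rewrite in_fset1 => /eqP ->.
by apply; rewrite in_fset1.
Qed.

(** Restriction identifies [R] with a polynomial ring in two variables, whose variables, lifted
    through [G], form a regular sequence. Three regular elements would give three successive cuts of
    the ideal of the line. *)
Lemma depth_one l : (M : {fset line K n}) = [fset l]%fset -> has_coord_depth M 2.
Proof.
move=> /lines_ideal_single Jl; have [G CG] := line_mx_inv l.
have rhoG f : linsub (line_mx l) (linsub G f) = f by exact: linsub_section.
have y0 i : linsub (line_mx l) (linsub G 'X_i) != 0 by rewrite rhoG mpolyX_neq0.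
split.
  have sm a : a \in [:: linsub G 'X_0; linsub G 'X_1] -> max_homog_ideal a.
    by rewrite !inE => /orP[]/eqP ->; exact: linform_max.
  exists [:: linsub G 'X_0; linsub G 'X_1]; split=> //; split=> //.
  split; last exact: in_seq_mul_proper.
  move=> [|[|//]] _ x; have [f ->] := coord_ring_pi_surj x; rewrite coord_ring_scaleE /=.
    by rewrite !in_seq_mul0 !Jl; apply: line_regular.
  rewrite !in_seq_mul1 => -[c /Jl]; rewrite raddfB /= !rmorphM /= !rhoG => /eqP.
  rewrite subr_eq0 => /eqP/mulX_exchange[g hg].
  by exists (linsub G g); apply/Jl; rewrite raddfB /= rmorphM /= !rhoG hg subrr.
move=> s [sm [reg _]]; rewrite leqNgt; apply/negP => s3.
(* [I k] is the preimage in [S] of the ideal generated in [R] by the first [k] entries of [s]. *)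
pose I k f := in_seq_mul (take k s) (pi f).
have cut k : (k < size s)%N -> cuts s`_k (I k) (I k.+1).
  move=> ks; split=> [x g|g].
    rewrite /I coord_ring_piD -coord_ring_scaleE (take_nth 0) //.
    exact: in_seq_mul_rcons.
  by rewrite /I -coord_ring_scaleE; apply: reg.
have kI g : linsub (line_mx l) g = 0 -> I 0%N g.
  by move=> g0; rewrite /I take0; apply/in_seq_mul0/Jl.
apply: (no_three_cuts kI (cut 0%N _) (cut 1%N _) (cut 2%N _)); try by apply: leq_trans s3.
move=> c /in_seq_mul_mcoeff0 h; rewrite -(h _) ?mcoeffC ?eqxx ?mulr1 //.
by move=> a /mem_take; apply: sm.
Qed.

End Dimension.

(** * Krull dimension of the coordinate ring *)

Section Krull.
Variables (K : numFieldType) (n : nat) (M : line_collection K n).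
Local Notation S := {mpoly K[n.+1]}.
Local Notation pi := (coord_ring_pi M).
Local Notation J := (lines_ideal M).

Definition some_line : line K n := xchoose (fset0Pn _ (lines_neq0 M)).

Lemma some_lineP : some_line \in (M : {fset line K n}).
Proof. exact: (xchooseP (fset0Pn _ (lines_neq0 M))). Qed.

(** Restriction to one line, followed by setting the first [k] of the two parameters to 0. For
    [k = 0, 1, 2] the kernels are the primes of the line, of a point on it, and of the vertex of the
    cone. *)
Definition line_restr k (x : coord_ring M) : {mpoly K[2]} :=
  linsub (killmx K 2 k *m line_mx some_line) (repr x : S).

Lemma line_restr_pi k f :
  line_restr k (pi f) = linsub (killmx K 2 k *m line_mx some_line) f.
Proof.
apply/eqP; rewrite -subr_eq0 /line_restr -raddfB /= -linsub_comp.
have /coord_ring_pi_eq0 h : pi (repr (pi f) - f) = 0.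
  by rewrite coord_ring_piB /coord_ring_pi reprK subrr.
by rewrite h ?raddf0 // some_lineP.
Qed.

Definition restr_ideal k : {pred coord_ring M} := fun x => line_restr k x == 0.

Lemma mem_restr_ideal k f :
  (pi f \in restr_ideal k) = (linsub (killmx K 2 k *m line_mx some_line) f == 0).
Proof. by rewrite -line_restr_pi. Qed.

Lemma restr_ideal_closed k : idealr_closed (restr_ideal k).
Proof.
split.
- by rewrite -(_ : pi 0 = 0) ?mem_restr_ideal ?raddf0 //; exact: rmorph0.
- by rewrite -coord_ring_pi1 mem_restr_ideal rmorph1 oner_eq0.
move=> a u v; have [f ->] := coord_ring_pi_surj a.
have [g ->] := coord_ring_pi_surj u; have [h ->] := coord_ring_pi_surj v.
rewrite -coord_ring_piM -coord_ring_piD !mem_restr_ideal => /eqP g0 /eqP h0.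
by rewrite rmorphD rmorphM /= g0 h0 mulr0 addr0.
Qed.

HB.instance Definition _ k :=
  isIdealr.Build (coord_ring M) (restr_ideal k) (restr_ideal_closed k).

Lemma restr_ideal_prime k : prime_idealr_closed (restr_ideal k).
Proof.
move=> u v; have [g ->] := coord_ring_pi_surj u; have [h ->] := coord_ring_pi_surj v.
by rewrite -coord_ring_piM !mem_restr_ideal rmorphM mulf_eq0.
Qed.

HB.instance Definition _ k :=
  isPrimeIdealrClosed.Build (coord_ring M) (restr_ideal k) (@restr_ideal_prime k).

Definition restr_prime k : prime_idealr (coord_ring M) := restr_ideal k.

Lemma mem_restr_prime k f : reflect
  (linsub (killmx K 2 k *m line_mx some_line) f = 0) (pi f \in restr_prime k).
Proof. by rewrite mem_restr_ideal; apply: eqP. Qed.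

(** Otherwise choose for every line an element of its ideal outside [P]; the product vanishes on all
    the lines, hence is 0 in [R], yet stays outside the prime [P]. *)
Lemma prime_contains_line (P : prime_idealr (coord_ring M)) :
  exists l, forall f, linsub (line_mx l) f = 0 -> pi f \in P.
Proof.
apply: contrapT => /forallNP noline.
have wit l : exists f, linsub (line_mx l) f = 0 /\ pi f \notin P.
  have /existsNP[f hf] := noline l; exists f.
  by split; [apply: contrapT | apply/negP] => h; apply: hf.
have prod (s : seq (line K n)) : exists f, pi f \notin P /\
    forall l, l \in s -> linsub (line_mx l) f = 0.
  elim: s => [|l s [f [fP fs]]].
    by exists 1; rewrite coord_ring_pi1; split=> //; rewrite idealr1.
  have [g [gl gP]] := wit l; exists (f * g); split=> [|x].
    by rewrite coord_ring_piM prime_idealrM negb_or fP.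
  by rewrite in_cons rmorphM /= => /orP[/eqP ->|/fs ->]; rewrite ?gl ?mulr0 ?mul0r.
have [f [/negP fP fM]] := prod (enum_fset M); apply: fP.
by rewrite (coord_ring_pi_eq0 M f).2 // idealr0.
Qed.

Lemma krull_dim_lines : has_coord_dim M 2.
Proof.
split.
  exists (fun i : 'I_3 => restr_prime i) => i j ij; split.
    move=> x; have [f ->] := coord_ring_pi_surj x.
    move/(mem_restr_prime i) => f0; apply/(mem_restr_prime j).
    rewrite -(maxn_idPr (ltnW ij)) maxnC -killmx_mul -mulmxA -linsub_comp f0.
    by rewrite raddf0.
  have i2 : (i < 2)%N by have := ltn_ord j; lia.
  have [G CG] := line_mx_inv some_line.
  have rG k : linsub (killmx K 2 k *m line_mx some_line)
      (linsub G 'X_(Ordinal i2)) = if (k <= i)%N then 'X_(Ordinal i2) else 0.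
    by rewrite linsub_comp -mulmxA CG mulmx1 linsub_killX.
  (* The lift of the parameter of index [i] is set to 0 at stage [j > i] but survives at stage
     [i]. *)
  move/(_ (pi (linsub G 'X_(Ordinal i2)))); apply/implyP; rewrite negb_imply.
  apply/andP; split; first by apply/(mem_restr_prime j); rewrite rG leqNgt ij.
  by apply/(mem_restr_prime i); rewrite rG leqnn; apply/eqP/mpolyX_neq0.
move=> k P chain; rewrite leqNgt; apply/negP => k3.
(* Pull the chain back to [S]: an element of the larger of two successive primes outside the smaller
   one is a cut, and three cuts starting above a line ideal are impossible. *)
pose I j f := pi f \in P (inord j).
have cut j : (j < k)%N -> exists f, cuts f (I j) (I j.+1).
  move=> jk; have [|sub /existsNP[x]] := chain (inord j) (inord j.+1).
    by rewrite !inordK //; lia.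
  have [f ->] := coord_ring_pi_surj x => /not_implyP[fj1 /negP/negPf fj].
  exists f; split=> [y g|g]; rewrite /I ?coord_ring_piD coord_ring_piM.
    by move=> /sub; rewrite rpredDr // mulrC idealMr.
  by rewrite prime_idealrM fj.
have [l hl] := prime_contains_line (P (inord 0)).
have [f0 c0] := cut 0%N (ltnW (ltnW k3)).
have [f1 c1] := cut 1%N (ltnW k3).
have [f2 c2] := cut 2%N k3.
apply: (no_three_cuts hl c0 c1 c2) => c hc.
apply/eqP/negPn/negP => c0'.
have : pi ((c^-1)%:MP * c%:MP) \in P (inord 3).
  by rewrite coord_ring_piM idealMr.
by rewrite -mpolyCM mulVf // mpolyC1 coord_ring_pi1 idealr1.
Qed.

End Krull.

(** * Lengths of minimal resolutions *)

Section Homology.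
Variables (K : fieldType) (N : nat).
Local Notation S := {mpoly K[N]}.
Variables (V : lmodType S) (F : free_complex V).
Hypothesis F_exact : exact_complex F.
Variable Q : 'M[K]_N.
Hypothesis Q_unit : Q \in unitmx.

(* The columns of [Q] give linear forms [form 0, ..., form (N - 1)] generating
   the maximal ideal, and [mod_forms k] is reduction modulo the first [k] of
   them. *)
Definition form (j : 'I_N) : S := linsub Q 'X_j.
Definition mod_forms k : S -> S := linsub (killmx K N k *m invmx Q).
HB.instance Definition _ k := GRing.LRMorphism.copy (mod_forms k)
  (linsub (killmx K N k *m invmx Q)).

Lemma mod_forms_form k j : mod_forms k (form j) = if (k <= j)%N then 'X_j else 0.
Proof. by rewrite /mod_forms linsub_comp -mulmxA mulVmx // mulmx1 linsub_killX. Qed.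

Lemma mod_forms0_inj f : mod_forms 0 f = 0 -> f = 0.
Proof.
rewrite /mod_forms killmx0 mul1mx => /(congr1 (linsub Q)).
by rewrite linsub_comp mulmxV // linsub1 raddf0.
Qed.

Lemma mod_forms_full f : mod_forms N f = (f@_0)%:MP.
Proof. by rewrite /mod_forms killmx_full mul0mx linsub0. Qed.

Lemma mod_formsS k f : mod_forms k f = 0 -> mod_forms k.+1 f = 0.
Proof.
rewrite /mod_forms => f0.
by rewrite -(maxn_idPl (leqnSn k)) -killmx_mul -mulmxA -linsub_comp f0 raddf0.
Qed.

(** In the coordinates given by the forms, this is division by the variable ['X_k]. *)
Lemma mod_forms_split (k : 'I_N) f :
  mod_forms k.+1 f = 0 -> exists g, mod_forms k (f - form k * g) = 0.
Proof.
move=> f0; have [g] := mulX_of_kill k (linsub (invmx Q) f).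
set B := \matrix_(i, j) _ => hg; exists (linsub Q g).
have kB : killmx K N k *m B = killmx K N k.+1.
  apply/matrixP => i j; rewrite mxE (bigD1 i) //= !mxE eqxx big1 => [|l /negPf li].
    rewrite addr0 -natrM mulnb; case: (i == j); rewrite ?andbF //=.
    by rewrite ltn_neqAle andbC eq_sym.
  by rewrite !mxE eq_sym li mul0r.
rewrite raddfB /= rmorphM /= mod_forms_form leqnn.
move: f0; rewrite /mod_forms -!linsub_comp [linsub (invmx Q) (linsub Q g)]linsub_comp.
rewrite mulVmx // linsub1.
move: hg; set h := linsub (invmx Q) f => hg f0; rewrite {1}hg raddfD /= linsub_comp kB f0.
by rewrite add0r rmorphM /= linsub_killX leqnn subrr.
Qed.

Local Notation red k := (map_mx (mod_forms k)).

Lemma red_split (k : 'I_N) r (u : 'rV[S]_r) :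
  red k.+1 u = 0 -> exists w, red k (u - form k *: w) = 0.
Proof.
move=> /rowP u0; have h j : exists g, mod_forms k (u 0 j - form k * g) = 0.
  by apply: mod_forms_split; have := u0 j; rewrite !mxE.
have [g hg] := choice h; exists (\row_j g j).
by apply/rowP => j; rewrite !mxE hg.
Qed.

Lemma red_formZ (k : 'I_N) r (u : 'rV[S]_r) :
  red k (form k *: u) = 0 -> red k u = 0.
Proof.
move=> /rowP u0; apply/rowP => j; move/eqP: (u0 j); rewrite !mxE.
rewrite rmorphM /= mod_forms_form leqnn mulf_eq0.
by rewrite -msize_poly_eq0 msizeX => /eqP.
Qed.

Lemma redS k r (u : 'rV[S]_r) : red k u = 0 -> red k.+1 u = 0.
Proof.
move=> /rowP u0; apply/rowP => j; have := u0 j.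
by rewrite !mxE => /mod_formsS.
Qed.

Lemma red_mul k r s (u : 'rV[S]_r) (D : 'M[S]_(r, s)) :
  red k u = 0 -> red k (u *m D) = 0.
Proof. by move=> u0; rewrite map_mxM u0 mul0mx. Qed.

Lemma redD k r (u v : 'rV[S]_r) : red k u = 0 -> red k v = 0 -> red k (u + v) = 0.
Proof. by move=> u0 v0; rewrite map_mxD u0 v0 addr0. Qed.

Lemma redZ k r a (u : 'rV[S]_r) : red k u = 0 -> red k (a *: u) = 0.
Proof. by move=> u0; rewrite map_mxZ u0 scaler0. Qed.

Lemma redN k r (u : 'rV[S]_r) : red k u = 0 -> red k (- u) = 0.
Proof. by move=> u0; rewrite map_mxN u0 oppr0. Qed.

(** The homology of [F] modulo the first [k] forms is handled on representatives over [S], without a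
    quotient complex. In degree 0 everything is a cycle. *)
Definition cycle k i : 'rV[S]_(rank F i) -> Prop :=
  if i is j.+1 return 'rV[S]_(rank F i) -> Prop
  then fun u => red k (u *m diff F j) = 0 else fun=> True.

Definition boundary k i (u : 'rV[S]_(rank F i)) : Prop :=
  exists v, red k (u - v *m diff F i) = 0.

Definition acyclic k i : Prop := forall u, @cycle k i u -> @boundary k i u.

Lemma diff_diff i (u : 'rV[S]_(rank F i.+2)) :
  u *m diff F i.+1 *m diff F i = 0.
Proof. by have [_ _ ex] := F_exact; apply/ex; exists u. Qed.

Lemma cycle_of_diff (k : 'I_N) i (u : 'rV[S]_(rank F i.+1)) w :
  red k (u *m diff F i - form k *: w) = 0 -> @cycle k i w.
Proof.
case: i u w => [//|i] u w /(red_mul (diff F i)).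
rewrite mulmxBl diff_diff sub0r -scalemxAl map_mxN => /eqP.
by rewrite oppr_eq0 => /eqP/red_formZ.
Qed.

(** From the long exact sequence of multiplication by [form k] on [F] modulo [k] forms: homology in
    degree [i.+1] modulo [k.+1] forms lies between a zero group and the kernel of [form k] on
    homology in degree [i]. *)
Lemma acyclic_step (k : 'I_N) i : acyclic k i.+1 ->
    (forall u, @cycle k i u -> @boundary k i (form k *: u) -> @boundary k i u) ->
  acyclic k.+1 i.+1.
Proof.
(* [w] represents the image of the class of [u] under the connecting map. *)
move=> ac reg u /red_split[w hw].
have [|v hv] := reg w (cycle_of_diff hw).
  exists u; move: hw; rewrite map_mxB => /eqP; rewrite subr_eq0 => /eqP hw.
  by rewrite map_mxB hw subrr.
have cuv : @cycle k i.+1 (u - form k *: v).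
  rewrite /cycle mulmxBl -scalemxAl.
  have -> : u *m diff F i - form k *: (v *m diff F i) =
      (u *m diff F i - form k *: w) + form k *: (w - v *m diff F i).
    by rewrite scalerBr addrA subrK.
  by apply: redD hw _; exact: redZ.
have [v' hv'] := ac _ cuv; exists v'.
have -> : u - v' *m diff F i.+1 =
    (u - form k *: v - v' *m diff F i.+1) + form k *: v.
  by rewrite [in RHS]addrAC subrK.
by rewrite map_mxD redS // add0r map_mxZ /= mod_forms_form ltnn scale0r.
Qed.

(** A class [u] killed by [form k] is the connecting image of a class [w] one degree higher, which
    is nonzero since [u] is. The connecting map is injective by [acyclic k i.+1], so whatever kills
    [u] kills [w]. *)
Lemma socle_step (k : 'I_N) i (u : 'rV[S]_(rank F i)) (P : S -> Prop) :
    acyclic k i.+1 -> ~ @boundary k i u -> @boundary k i (form k *: u) ->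
    (forall b, P b -> @boundary k i (b *: u)) ->
  exists u', [/\ @cycle k.+1 i.+1 u', ~ @boundary k.+1 i.+1 u' &
    forall b, P b -> @boundary k.+1 i.+1 (b *: u')].
Proof.
move=> ac ub [w hw] Pb; exists w; split.
- rewrite /cycle; have -> : red k.+1 (w *m diff F i) =
      - red k.+1 (form k *: u - w *m diff F i).
    by rewrite map_mxB map_mxZ /= mod_forms_form ltnn scale0r sub0r opprK.
  by rewrite redS ?oppr0.
- move=> [v /red_split[t ht]]; apply: ub; exists (t : 'rV_(rank F i.+1)).
  apply: red_formZ; rewrite scalerBr scalemxAl.
  have /(red_mul (diff F i)) := ht; rewrite !mulmxBl diff_diff subr0.
  move=> h; have -> : form k *: u - form k *: t *m diff F i =
      (form k *: u - w *m diff F i) + (w *m diff F i - form k *: t *m diff F i).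
    by rewrite addrA subrK.
  exact: redD hw h.
move=> b /Pb[w' hw'].
have cw : @cycle k i.+1 (b *: w - form k *: w').
  rewrite /cycle mulmxBl -!scalemxAl.
  have -> : b *: (w *m diff F i) - form k *: (w' *m diff F i) =
      form k *: (b *: u - w' *m diff F i) - b *: (form k *: u - w *m diff F i).
    by rewrite !scalerBr !scalerA [b * form k]mulrC opprB [RHS]addrC addrA subrK.
  exact: redD (redZ _ hw') (redN (redZ _ hw)).
have [v hv] := ac _ cw; exists v.
have -> : b *: w - v *m diff F i.+1 =
    (b *: w - form k *: w' - v *m diff F i.+1) + form k *: w'.
  by rewrite [in RHS]addrAC subrK.
by rewrite map_mxD redS // add0r map_mxZ /= mod_forms_form ltnn scale0r.
Qed.

Lemma acyclic0 i : acyclic 0 i.+1.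
Proof.
move=> u u0; have [_ _ /(_ i u)[ex _]] := F_exact.
have /ex[v ->] : u *m diff F i = 0.
  by apply/rowP => j; move/rowP/(_ j): u0; rewrite !mxE => /mod_forms0_inj.
by exists v; rewrite subrr map_mx0.
Qed.

Variable d : nat.
Hypothesis d_le : (d <= N)%N.
(** Degree 0 homology modulo [k] forms is [V] modulo these forms, so this says that each of the
    first [d] forms is a nonzerodivisor on [V] modulo the preceding ones. *)
Hypothesis F_reg : forall (k : 'I_N) u, (k < d)%N ->
  @boundary k 0 (form k *: u) -> @boundary k 0 u.

(** Homology stays in degree 0 through the first [d] forms; each later form raises the top degree by
    at most one. *)
Lemma acyclic_above k i : (k <= N)%N -> (k < i + minn k d)%N -> acyclic k i.
Proof.
elim: k i => [|k IH] [|i] kN ki; try by lia.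
  exact: acyclic0.
apply: (@acyclic_step (Ordinal kN)) => /=; first by apply: IH; lia.
(* In degree 0 the bound forces [k < d], where regularity applies; in positive degree the homology
   modulo [k] forms already vanishes. *)
case: i ki => [|i] ki u cu; first by apply: (F_reg (k := Ordinal kN)) => /=; lia.
by move=> _; apply: (IH i.+1 _ _ _ cu); lia.
Qed.

Lemma socle_above m u0 : ~ @boundary d 0 u0 ->
    (forall j : 'I_N, (d <= j)%N -> @boundary d 0 (form j *: u0)) ->
    (d + m <= N)%N ->
  exists u, [/\ @cycle (d + m) m u, ~ @boundary (d + m) m u &
    forall j : 'I_N, (d + m <= j)%N -> @boundary (d + m) m (form j *: u)].
Proof.
move=> u0b u0s; elim: m => [|m IH] dN.
  by exists u0; rewrite addn0.
have dmN : (d + m < N)%N by lia.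
have [|u [cu ub us]] := IH; first by lia.
have ac : acyclic (Ordinal dmN) m.+1 by apply: acyclic_above => /=; lia.
pose P (b : S) := exists2 j : 'I_N, (d + m < j)%N & b = form j.
have [||u' [cu' ub' us']] := @socle_step (Ordinal dmN) m u P ac ub.
- exact: us.
- by move=> b [j jd ->]; apply: us; lia.
by rewrite addnS; exists u'; split=> // j jd; apply: us'; exists j.
Qed.

Hypothesis F_min : minimal_complex F.

(** Modulo all the forms only constant terms remain, so minimality makes every differential 0, and a
    basis vector would be a cycle that is not a boundary. *)
Lemma acyclic_rank i : acyclic N i -> rank F i = 0%N.
Proof.
move=> ac; apply/eqP; rewrite -leqn0 leqNgt; apply/negP => r0.
pose u : 'rV[S]_(rank F i) := delta_mx 0 (Ordinal r0).
have [|v /rowP/(_ (Ordinal r0))] := ac u.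
  rewrite /u; move: r0 {u ac}; case: i => [//|i] r0; rewrite /cycle -rowE.
  apply/rowP => k; rewrite !mxE mod_forms_full.
  by rewrite (max_homog_idealP _).1 ?mpolyC0 //; exact: F_min.
rewrite !mxE !eqxx raddfB /= !mod_forms_full mcoeff1 eqxx raddf_sum big1 => [|k _].
  by rewrite mpolyC0 subr0 => /eqP; rewrite mpolyC1 oner_eq0.
by rewrite /= mcoeff0M [X in _ * X](max_homog_idealP _).1 ?mulr0 //; exact: F_min.
Qed.

Lemma length_of_socle u0 : ~ @boundary d 0 u0 ->
    (forall j : 'I_N, (d <= j)%N -> @boundary d 0 (form j *: u0)) ->
  has_length F (N - d).
Proof.
move=> u0b u0s; split=> [r0|i iN].
  have [|u [_ ub _]] := @socle_above (N - d) u0 u0b u0s; first by lia.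
  by apply: ub; exists 0; apply/rowP => j; have := ltn_ord j; rewrite {2}r0.
by apply: acyclic_rank; apply: acyclic_above => //; lia.
Qed.

End Homology.

Section ProjectiveDimension.
Variables (K : numFieldType) (n : nat) (M : line_collection K n).
Local Notation S := {mpoly K[n.+1]}.
Local Notation pi := (coord_ring_pi M).
Local Notation J := (lines_ideal M).
Variable F : free_complex (coord_ring M).
Hypothesis F_exact : exact_complex F.
Variable Q : 'M[K]_n.+1.
Hypothesis Q_unit : Q \in unitmx.

(** The augmentation identifies degree 0 homology modulo [k] forms with [R] modulo these forms. One
    direction expands [u - v *m diff F 0] in the basis of the free module; the other subtracts [h]
    times a preimage of 1 and uses exactness. *)
Lemma boundary0_pi k (u : 'rV[S]_(rank F 0)) f : aug F u = pi f ->
  boundary Q k u <-> exists h, mod_forms Q k h = 0 /\ J (f - h).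
Proof.
move=> uf; have [surj ex _] := F_exact; split=> [[v hv]|[h [h0 hf]]].
  have [g hg] := choice (fun j => coord_ring_pi_surj (aug F (delta_mx 0 j))).
  set w := u - _ in hv; exists (\sum_j w 0 j * g j); split.
    rewrite raddf_sum big1 // => j _ /=; rewrite rmorphM /=.
    by move/rowP/(_ j): hv; rewrite !mxE => ->; rewrite mul0r.
  apply/coord_ring_pi_eq0; rewrite coord_ring_piB coord_ring_pi_sum -uf.
  have aw : aug F w = aug F u.
    rewrite /w raddfB /= [X in _ - X](_ : _ = 0) ?subr0 //.
    by apply/ex; exists v.
  rewrite -aw {1}[w]row_sum_delta linear_sum /=; apply/eqP; rewrite subr_eq0.
  by apply/eqP/eq_bigr => j _; rewrite linearZ /= hg coord_ring_scaleE.
have [e ae] := surj (pi 1).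
have /ex[v hv] : aug F (u - h *: e) = 0.
  rewrite linearB linearZ /= uf ae coord_ring_scaleE mulr1 -coord_ring_piB.
  exact/coord_ring_pi_eq0.
exists v; rewrite -hv opprB addrC subrK map_mxZ /= h0.
by rewrite scale0r.
Qed.

Lemma form_extend p (G : 'M[K]_(n.+1, p)) (j : 'I_p) (k : 'I_n.+1) :
    (forall i (j : 'I_p) (k : 'I_n.+1), j = k :> nat -> Q i k = G i j) ->
  j = k :> nat -> form Q k = linsub G 'X_j.
Proof.
by move=> QG jk; rewrite /form !linsubX; apply: eq_bigr => i _; rewrite (QG _ j).
Qed.

Lemma aug_pi (u : 'rV[S]_(rank F 0)) : exists f, aug F u = pi f.
Proof. exact: coord_ring_pi_surj. Qed.

Lemma aug_scale a (u : 'rV[S]_(rank F 0)) f :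
  aug F u = pi f -> aug F (a *: u) = pi (a * f).
Proof. by move=> uf; rewrite linearZ /= uf coord_ring_scaleE. Qed.

Lemma boundary_regular0 (k : 'I_n.+1) (u : 'rV[S]_(rank F 0)) : k = 0 :> nat ->
    (forall l, l \in (M : {fset line K n}) -> linsub (line_mx l) (form Q k) != 0) ->
  boundary Q k (form Q k *: u) -> boundary Q k u.
Proof.
move=> k0 y0; have [f uf] := aug_pi u.
rewrite (boundary0_pi _ (aug_scale _ uf)) (boundary0_pi _ uf) k0.
move=> -[h [/mod_forms0_inj h0 hf]].
exists 0; split; first exact: raddf0.
rewrite subr0 => l lM; apply: (line_regular (y0 l lM)).
by have := hf l lM; rewrite h0 // subr0.
Qed.

End ProjectiveDimension.

(** * Lengths of minimal resolutions for several lines and for one line *)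

Section Lengths.
Variables (K : numFieldType) (n : nat) (M : line_collection K n).
Local Notation S := {mpoly K[n.+1]}.
Local Notation pi := (coord_ring_pi M).
Local Notation J := (lines_ideal M).
Variable F : free_complex (coord_ring M).
Hypothesis F_res : minimal_graded_free_resolution (@coord_ring_deg K n M) F.

Let F_exact : exact_complex F. Proof. by case: F_res. Qed.
Let F_min : minimal_complex F. Proof. by case: F_res. Qed.

Lemma form_mcoeff0 (Q : 'M[K]_n.+1) j : (form Q j)@_0 = 0.
Proof. by rewrite linsub_mcoeff0 mcoeffX mnm1_eq0. Qed.

Lemma length_many : (3 <= n)%N -> general_linear_position M -> (2 <= #|` M|)%N ->
  has_length F n.
Proof.
move=> n_ge3 M_gen M2.
have [l1 l1M] := fset0Pn _ (lines_neq0 M).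
have [l2] : exists l2, l2 \in ((M : {fset line K n}) `\ l1)%fset.
  apply/fset0Pn; rewrite -cardfs_gt0.
  by have := cardfsD1 l1 M; rewrite l1M => e; move: M2; rewrite e.
rewrite in_fsetD1 => /andP[l21 l2M].
have [c hc] := exists_nonvanishing_form M.
(* [c] is nonzero because its form does not vanish on [l1]; a left inverse allows [c] to become the
   first column of an invertible [Q]. *)
have [C Cc] : exists C : 'rV_n.+1, C *m c = 1%:M.
  have [i ci] : exists i, c i 0 != 0.
    apply/existsP; apply: contraNT (hc _ l1M) => /existsPn c0.
    have -> : c = 0.
      by apply/matrixP => i j; rewrite ord1 mxE; have := c0 i; rewrite negbK => /eqP.
    by rewrite linsub0 mcoeffX mnm1_eq0 mpolyC0 raddf0.
  exists ((c i 0)^-1 *: delta_mx 0 i); rewrite -scalemxAl -rowE.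
  by apply/matrixP => j k; rewrite !ord1 !mxE mulVf.
have [Q Q_unit Qc] := extend_unitmx Cc.
have f0 : form Q ord0 = linsub c 'X_0 by apply: form_extend.
have y0 l : l \in (M : {fset line K n}) -> linsub (line_mx l) (form Q ord0) != 0.
  by rewrite f0; apply: hc.
(* With all the forms as multipliers, [x] gives a nonzero socle class of [R] modulo the first form;
   the length criterion is applied with [d = 1]. *)
have [x [xa xb]] := @socle_mod_nonzerodivisor K n M M_gen n_ge3 l1 l2 l1M l2M l21
  (form Q ord0) [seq form Q j | j : 'I_n.+1] y0 (form_mcoeff0 Q ord0)
  (fun b bs => let: ex_intro2 j _ e := mapP bs in etrans (congr1 _ e) (form_mcoeff0 Q j)).
have [surj _ _] := F_exact; have [u0 u0x] := surj (pi x).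
suff : has_length F (n.+1 - 1) by rewrite subn1.
apply: (length_of_socle F_exact Q_unit _ _ F_min (u0 := u0)) => //.
- move=> k u k0; have {}k0 : k = ord0 by apply: val_inj => /=; case: (val k) k0.
  by rewrite k0; apply: boundary_regular0.
- rewrite (boundary0_pi F_exact _ _ u0x) => -[h [/(@mod_forms_split _ _ _ Q_unit ord0)[g]]].
  move=> /(mod_forms0_inj Q_unit) hg hx; apply: xa; exists g.
  by rewrite -(subrK h x) -addrA hg addr0.
move=> j _; rewrite (boundary0_pi F_exact _ _ (aug_scale _ u0x)).
have [|y hy] := xb (form Q j); first by apply: map_f; rewrite mem_enum.
exists (form Q ord0 * y); split=> //.
by rewrite rmorphM /= mod_forms_form // mul0r.
Qed.

(** Here [d = 2]: the first two forms lift the parameters of the line and are regular on [R], and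
    the class of 1 is a nonzero socle element of the quotient by them. *)
Lemma length_one l : (2 <= n)%N -> (M : {fset line K n}) = [fset l]%fset ->
  has_length F (n - 1).
Proof.
move=> n_ge2 Ml; have Jl := lines_ideal_single Ml.
 have [G CG] := line_mx_inv l; have [Q Q_unit QG] := extend_unitmx CG.
have rhoG f : linsub (line_mx l) (linsub G f) = f by exact: linsub_section.
have lM l' : l' \in (M : {fset line K n}) -> l' = l.
  by rewrite Ml in_fset1 => /eqP.
have n1 : (1 < n.+1)%N by lia.
have f0 : form Q ord0 = linsub G 'X_0 by apply: form_extend.
have f1 : form Q (Ordinal n1) = linsub G 'X_1 by apply: form_extend.
have [surj _ _] := F_exact; have [u0 u0x] := surj (pi 1).
suff : has_length F (n.+1 - 2) by rewrite subSS.
apply: (length_of_socle F_exact Q_unit _ _ F_min (u0 := u0)) => //.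
- move=> k u k2; have [k0|k1] : k = ord0 \/ k = Ordinal n1.
    by case: k k2 => -[|[|]] // *; [left|right]; apply: val_inj.
  + rewrite k0; apply: (boundary_regular0 F_exact Q_unit) => // l' /lM ->.
    by rewrite f0 rhoG mpolyX_neq0.
  have [f uf] := aug_pi u.
  rewrite (boundary0_pi F_exact _ _ (aug_scale _ uf)) (boundary0_pi F_exact _ _ uf) k1.
  move=> -[h [/(@mod_forms_split _ _ _ Q_unit ord0)[g /(mod_forms0_inj Q_unit)/eqP]]].
  rewrite subr_eq0 => /eqP -> /Jl; rewrite raddfB /= !rmorphM /= f0 f1 !rhoG => /eqP.
  rewrite subr_eq0 => /eqP/mulX_exchange[q hq]; exists (form Q ord0 * linsub G q).
  split; first by rewrite rmorphM /= mod_forms_form // mul0r.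
  by apply/Jl; rewrite raddfB /= rmorphM /= f0 !rhoG hq subrr.
- rewrite (boundary0_pi F_exact _ _ u0x) => -[h [h0 /lines_ideal_mcoeff0]].
  rewrite mcoeffB -(linsub_mcoeff0 (killmx K n.+1 2 *m invmx Q) h).
  rewrite -/(mod_forms Q 2 h) h0 mcoeff0 subr0 mcoeff1 eqxx => /eqP.
  by rewrite oner_eq0.
move=> j _; rewrite (boundary0_pi F_exact _ _ (aug_scale _ u0x)).
(* Modulo the ideal of [l], a form equals the lift of its restriction, and this lift is a
   combination of the first two forms. *)
exists (linsub G (linsub (line_mx l) (form Q j))); split; last first.
  by apply/Jl; rewrite mulr1 raddfB /= rhoG subrr.
have G0 : killmx K n.+1 2 *m invmx Q *m G = 0.
  apply/matrixP => a b; rewrite [RHS]mxE; apply: linsubX_eq0; rewrite -linsub_comp.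
  have [b0|b1] : b = 0 \/ b = 1.
  - by case: b => -[|[|]] // b2; [left|right]; apply: val_inj.
  - by rewrite b0 -f0 -/(mod_forms Q 2 _) mod_forms_form.
  by rewrite b1 -f1 -/(mod_forms Q 2 _) mod_forms_form.
rewrite /mod_forms linsub_comp G0 linsub0 linsub_mcoeff0 form_mcoeff0.
exact: mpolyC0.
Qed.

End Lengths.

(** * Hilbert's basis theorem *)

Lemma in_ideal_gen_sub (A : comNzRingType) (G G' : A -> Prop) x :
  (forall a, G a -> in_ideal_gen G' a) -> in_ideal_gen G x -> in_ideal_gen G' x.
Proof.
move=> GG' [s [hs ->]]; rewrite big_seq.
apply: (big_ind (in_ideal_gen G')); [exact: in_ideal_gen0|exact: in_ideal_genD|].
by move=> p /hs /GG'; apply: in_ideal_genMl.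
Qed.

Definition is_ideal (A : comNzRingType) (I : A -> Prop) : Prop :=
  [/\ I 0, forall x y, I x -> I y -> I (x + y) & forall a x, I x -> I (a * x)].

Definition noetherian (A : comNzRingType) : Prop :=
  forall I : A -> Prop, is_ideal I ->
    exists s : seq A, (forall a, a \in s -> I a) /\
      forall x, I x -> in_ideal_gen (fun a => a \in s) x.

Lemma ideal_gen_sub (A : comNzRingType) (I G : A -> Prop) x : is_ideal I ->
  (forall a, G a -> I a) -> in_ideal_gen G x -> I x.
Proof.
move=> [I0 ID IM] GI [s [hs ->]]; rewrite big_seq.
by apply: (big_ind I) => // p /hs /GI; apply: IM.
Qed.

Lemma noetherian_surj (A B : comNzRingType) (phi : {rmorphism A -> B}) :
  (forall b, exists a, phi a = b) -> noetherian A -> noetherian B.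
Proof.
move=> surj noethA I [I0 ID IM].
have [|s [sI sgen]] := noethA (fun a => I (phi a)).
  split=> [|x y|a x]; first by rewrite rmorph0.
    by rewrite rmorphD; apply: ID.
  by rewrite rmorphM; apply: IM.
exists (map phi s); split=> [_ /mapP[a /sI Ia ->] //|b Ib].
have [a ab] := surj b; have [|t [ts e]] := sgen a; first by rewrite ab.
exists [seq (phi p.1, phi p.2) | p <- t]; split=> [_ /mapP[p /ts ps ->]|].
  exact: map_f.
rewrite -ab e rmorph_sum big_map; apply: eq_bigr => p _ /=.
exact: rmorphM.
Qed.

Section HilbertBasis.
Variables (A : comNzRingType) (noethA : noetherian A).
Variables (I : {poly A} -> Prop) (I_ideal : is_ideal I).

(** Leading coefficients in degree [d]; the value 0 is allowed, which makes this an ideal. *)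
Let lead d (a : A) : Prop := exists p, [/\ I p, (size p <= d.+1)%N & p`_d = a].

Let lead_ideal d : is_ideal (lead d).
Proof.
have [I0 ID IM] := I_ideal; split=> [|x y [p [Ip sp <-]] [q [Iq sq <-]]|a x [p [Ip sp <-]]].
- by exists 0; rewrite size_poly0 coef0.
- exists (p + q); split; [exact: ID| |by rewrite coefD].
  by apply: leq_trans (size_polyD _ _) _; rewrite geq_max sp.
exists (a%:P * p); split; [exact: IM| |by rewrite coefCM].
by rewrite mul_polyC; apply: leq_trans (size_scale_leq _ _) sp.
Qed.

(** Lifts of the generators, multiplied by ['X^(e - d)], realize their combinations as leading
    coefficients in any degree [e >= d]. *)
Let lift_lead d (s : seq A) : (forall a, a \in s -> lead d a) ->
  exists T : seq {poly A}, (forall p, p \in T -> I p) /\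
    forall e x, (d <= e)%N -> in_ideal_gen (fun a => a \in s) x ->
      exists h, [/\ in_ideal_gen (fun p => p \in T) h, (size h <= e.+1)%N & h`_e = x].
Proof.
move=> sl; have /choice[f hf] a : exists p, a \in s ->
    [/\ I p, (size p <= d.+1)%N & p`_d = a].
  by case: (boolP (a \in s)) => [/sl[p hp]|_]; [exists p|exists 0].
exists (map f s); split=> [_ /mapP[a /hf[Ip _ _] ->] //|e x de [t [ts ->]]].
exists (\sum_(p <- t) (p.1 *: 'X^(e - d)) * f p.2); split.
- exists [seq (p.1 *: 'X^(e - d), f p.2) | p <- t]; rewrite big_map; split=> //.
  by move=> _ /mapP[p /ts ps ->]; apply: map_f.
- rewrite big_seq; apply: (big_ind (fun h : {poly A} => (size h <= e.+1)%N)).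
  + by rewrite size_poly0.
  + by move=> p q sp sq; apply: leq_trans (size_polyD _ _) _; rewrite geq_max sp.
  move=> p /ts/hf[_ sf _]; rewrite -scalerAl; apply: leq_trans (size_scale_leq _ _) _.
  rewrite mulrC; apply: leq_trans (size_polyMleq _ _) _; rewrite size_polyXn.
  by rewrite addnS /=; move: (size _) sf => m; lia.
rewrite coef_sum !big_seq; apply: eq_bigr => p /ts/hf[_ _ fp].
by rewrite -scalerAl coefZ ['X^_ * _]mulrC coefMXn ltnNge leq_subr /= subKn // fp.
Qed.

Let gens_below d : exists T : seq {poly A}, (forall p, p \in T -> I p) /\
  forall p, I p -> (size p <= d)%N -> in_ideal_gen (fun q => q \in T) p.
Proof.
have [I0 ID IM] := I_ideal.
elim: d => [|d [T [TI Tgen]]].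
  exists [::]; split=> // p _; rewrite size_poly_leq0 => /eqP ->.
  exact: in_ideal_gen0.
have [s [sl sgen]] := noethA (lead_ideal d).
have [T' [T'I T'gen]] := lift_lead sl.
exists (T ++ T'); split=> [p|p Ip sp]; first by rewrite mem_cat => /orP[/TI|/T'I].
have [|h [hT' sh hp]] := T'gen d p`_d (leqnn _); first by apply: sgen; exists p.
rewrite -(subrK h p); apply: in_ideal_genD; last first.
  by apply: in_ideal_gen_sub hT' => q qT; apply: in_ideal_gen_mem; rewrite mem_cat qT orbT.
have Ih : I h by apply: ideal_gen_sub hT'.
apply: (@in_ideal_gen_sub _ (fun q => q \in T)).
  by move=> q qT; apply: in_ideal_gen_mem; rewrite mem_cat qT.
apply: Tgen; first by rewrite -mulN1r; apply: ID => //; apply: IM.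
apply/leq_sizeP => j; rewrite leq_eqVlt => /orP[/eqP <-|dj].
  by rewrite coefB hp subrr.
by rewrite coefB !nth_default ?subrr //; [exact: leq_trans sh _|exact: leq_trans sp _].
Qed.

(** The leading coefficients in all degrees form an ideal with finitely many generators, all
    occurring in one degree [D]. From degree [D] on, their lifts cancel leading terms; sizes up to
    [D] are covered by [gens_below]. *)
Lemma hilbert_basis : exists s : seq {poly A}, (forall p, p \in s -> I p) /\
  forall p, I p -> in_ideal_gen (fun q => q \in s) p.
Proof.
have [I0 ID IM] := I_ideal.
have leadS d e a : (d <= e)%N -> lead d a -> lead e a.
  move=> de [p [Ip sp <-]]; exists ('X^(e - d) * p); split; first exact: IM.
    apply: leq_trans (size_polyMleq _ _) _; rewrite size_polyXn addSn /=.
    by move: (size _) sp => m; lia.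
  by rewrite mulrC coefMXn ltnNge leq_subr /= subKn.
have [|s [sl sgen]] := noethA (I := fun a => exists d, lead d a).
  split=> [|x y [d dx] [e ey]|a x [d dx]].
  - by exists 0%N; case: (lead_ideal 0).
  - exists (maxn d e); case: (lead_ideal (maxn d e)) => _ lD _.
    by apply: lD; [apply: leadS dx; rewrite leq_maxl|apply: leadS ey; rewrite leq_maxr].
  by exists d; case: (lead_ideal d) => _ _; apply.
have [D sD] : exists D, forall a, a \in s -> lead D a.
  elim: s sl {sgen} => [|a s IH] sl; first by exists 0%N.
  have [|D sD] := IH; first by move=> b bs; apply: sl; rewrite inE bs orbT.
  have [d ad] := sl a (mem_head _ _); exists (maxn d D) => b.
  rewrite inE => /orP[/eqP ->|/sD bD]; first by apply: leadS ad; rewrite leq_maxl.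
  by apply: leadS bD; rewrite leq_maxr.
have [T [TI Tgen]] := gens_below D; have [T' [T'I T'gen]] := lift_lead sD.
exists (T ++ T'); split=> [p|]; first by rewrite mem_cat => /orP[/TI|/T'I].
suff gen m p : I p -> (size p <= m)%N -> in_ideal_gen (fun q => q \in T ++ T') p.
  by move=> p Ip; apply: gen Ip (leqnn _).
elim: m p => [|m IH] p Ip sp.
  by move: sp; rewrite size_poly_leq0 => /eqP ->; exact: in_ideal_gen0.
case: (leqP D m) => Dm; last first.
  apply: (@in_ideal_gen_sub _ (fun q => q \in T)).
    by move=> q qT; apply: in_ideal_gen_mem; rewrite mem_cat qT.
  by apply: Tgen => //; apply: leq_trans sp Dm.
have [|h [hT' sh hp]] := T'gen m p`_m Dm; first by apply: sgen; exists m, p.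
have Ih : I h by apply: ideal_gen_sub hT'.
rewrite -(subrK h p); apply: in_ideal_genD; last first.
  by apply: in_ideal_gen_sub hT' => q qT; apply: in_ideal_gen_mem; rewrite mem_cat qT orbT.
apply: IH; first by rewrite -mulN1r; apply: ID => //; apply: IM.
apply/leq_sizeP => j; rewrite leq_eqVlt => /orP[/eqP <-|dj].
  by rewrite coefB hp subrr.
by rewrite coefB !nth_default ?subrr //; [exact: leq_trans sh _|exact: leq_trans sp _].
Qed.

End HilbertBasis.

(** Induction on the variables: evaluation at the last variable maps univariate polynomials over
    [{mpoly K[n]}] onto [{mpoly K[n.+1]}]. *)
Lemma noetherian_mpoly (K : fieldType) n : noetherian {mpoly K[n]}.
Proof.
elim: n => [|n IH].
  apply: (@noetherian_surj K {mpoly K[0]} (@mpolyC 0 K)) => [f|I [I0 ID IM]].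
    by exists f@_0%MM; rewrite [RHS]nvar0_mpolyC.
  case: (pselect (exists2 a, I a & a != 0)) => [[a Ia a0]|none].
    exists [:: a]; split=> [b|x _]; first by rewrite mem_seq1 => /eqP ->.
    rewrite -[x](divfK a0); apply/in_ideal_genMl/in_ideal_gen_mem.
    by rewrite mem_seq1.
  exists [::]; split=> // x Ix; case: (eqVneq x 0) => [->|x0].
    exact: in_ideal_gen0.
  by case: none; exists x.
pose phi : {rmorphism {poly {mpoly K[n]}} -> {mpoly K[n.+1]}} :=
  horner_eval 'X_(@ord_max n) \o map_poly (@mwiden n K).
apply: (@noetherian_surj {poly {mpoly K[n]}} _ phi).
  move=> f; elim/mpoly_ring_ind: f => [c|i|f g [p <-] [q <-]|f g [p <-] [q <-]].
  - by exists (c%:MP)%:P; rewrite /phi /= /horner_eval map_polyC hornerC /= mwidenC.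
  - case: (unliftP ord_max i) => [j|] ->; last first.
      by exists 'X; rewrite /phi /= /horner_eval map_polyX hornerX.
    exists ('X_j)%:P; rewrite /phi /= /horner_eval map_polyC hornerC /= mwidenX.
    rewrite mnmwiden1; congr 'X_ _; apply: val_inj => /=.
    by rewrite /bump leqNgt ltn_ord.
  - by exists (p + q); rewrite rmorphD.
  by exists (p * q); rewrite rmorphM.
by move=> I; apply: hilbert_basis.
Qed.

(** * Existence of minimal graded free resolutions *)

Definition is_submodule (A : comNzRingType) (V : lmodType A) (U : V -> Prop) : Prop :=
  [/\ U 0, forall u v, U u -> U v -> U (u + v) & forall a u, U u -> U (a *: u)].

Lemma submodule_sum (A : comNzRingType) (V : lmodType A) (U : V -> Prop)
    (I : Type) (r : seq I) (P : pred I) (f : I -> V) : is_submodule U ->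
  (forall i, P i -> U (f i)) -> U (\sum_(i <- r | P i) f i).
Proof. by move=> [U0 UD _] Uf; apply: (big_ind U). Qed.

Lemma submoduleB (A : comNzRingType) (V : lmodType A) (U : V -> Prop) u v :
  is_submodule U -> U u -> U v -> U (u - v).
Proof. by move=> [_ UD UZ] Uu Uv; apply: UD => //; rewrite -scaleN1r; apply: UZ. Qed.

Lemma submodule_mul (A : comNzRingType) p r (U : 'rV[A]_r -> Prop)
    (v : 'rV[A]_p) (G : 'M[A]_(p, r)) :
  is_submodule U -> (forall i, U (row i G)) -> U (v *m G).
Proof.
move=> Usub UG; rewrite mulmx_sum_row; apply: submodule_sum => // i _.
by case: Usub => _ _; apply.
Qed.

(** Induction on the rank: combine lifts of generators of the ideal of first coordinates with
    generators of the submodule where the first coordinate is 0. *)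
Lemma noetherian_submodule (A : comNzRingType) : noetherian A ->
  forall r (U : 'rV[A]_r -> Prop), is_submodule U ->
    exists p (G : 'M[A]_(p, r)), forall u, U u <-> exists v, u = v *m G.
Proof.
move=> noethA; elim=> [|r IH] U Usub.
  exists 0%N, 0 => u; rewrite [u]thinmx0; split=> [_|_]; last by case: Usub.
  by exists 0; rewrite mul0mx.
have [U0 UD UZ] := Usub.
have [|s [sU sgen]] := noethA (fun a => exists2 u, U u & u 0 0 = a).
  split=> [|_ _ [u Uu <-] [v Uv <-]|a _ [u Uu <-]].
  - by exists 0; rewrite ?mxE.
  - by exists (u + v); rewrite ?mxE //; apply: UD.
  by exists (a *: u); rewrite ?mxE //; apply: UZ.
have /choice[f hf] a : exists u, a \in s -> U u /\ u 0 0 = a.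
  by case: (boolP (a \in s)) => [/sU[u Uu ua]|_]; [exists u|exists 0].
have embD (u v : 'rV[A]_r) :
    row_mx (0 : 'rV_1) (u + v) = row_mx 0 u + row_mx 0 v.
  by rewrite add_row_mx addr0.
have embZ a (u : 'rV[A]_r) : row_mx (0 : 'rV_1) (a *: u) = a *: row_mx 0 u.
  by rewrite scale_row_mx scaler0.
have [|q [G hG]] := IH (fun w => U (row_mx (0 : 'rV_1) w)).
  split=> [|u v Uu Uv|a u Uu]; first by rewrite row_mx0.
    by rewrite embD; apply: UD.
  by rewrite embZ; apply: UZ.
pose T := \matrix_(i < size s) f s`_i.
pose G' := row_mx (0 : 'M[A]_(q, 1)) G.
have rowT i : U (row i T) by rewrite rowK; have [] := hf _ (mem_nth 0 (ltn_ord i)).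
have rowG i : U (row i G').
  by rewrite row_row_mx row0; apply/hG; exists (delta_mx 0 i); rewrite rowE.
exists (size s + q)%N, (col_mx T G') => u; split=> [Uu|[v ->]]; last first.
  rewrite -[v]hsubmxK mul_row_col.
  by apply: UD; apply: submodule_mul.
have [c hc] : exists c : 'rV_(size s), u 0 0 = \sum_i c 0 i * s`_i.
  have [|t [ts ->]] := sgen (u 0 0); first by exists u.
  elim: t ts => [|p t IHt] ts.
    by exists 0; rewrite big_nil big1 // => i _; rewrite mxE mul0r.
  have [|c hc] := IHt; first by move=> x xt; apply: ts; rewrite inE xt orbT.
  have ps := ts p (mem_head _ _); have pi : (index p.2 s < size s)%N by rewrite index_mem.
  exists (c + p.1 *: delta_mx 0 (Ordinal pi)); rewrite big_cons hc addrC.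
  under [RHS]eq_bigr do rewrite mxE mulrDl.
  rewrite big_split /=; congr (_ + _); rewrite (bigD1 (Ordinal pi)) //= !mxE !eqxx mulr1.
  rewrite nth_index // big1 ?addr0 // => i /negPf ne.
  by rewrite !mxE ne andbF mulr0 mul0r.
have Uw : U (u - c *m T) by apply: submoduleB => //; apply: submodule_mul.
have w0 : lsubmx (u - c *m T : 'rV_(1 + r)) = 0.
  apply/matrixP => i j; rewrite !ord1 mxE [RHS]mxE.
  have -> : lshift r 0 = 0 :> 'I_(1 + r) by apply: val_inj.
  rewrite mxE hc; apply/eqP; rewrite addr_eq0 !mxE opprK; apply/eqP/eq_bigr => k _.
  by rewrite mxE; congr (_ * _); have [] := hf _ (mem_nth 0 (ltn_ord k)).
have /hG[v hv] : U (row_mx (0 : 'rV_1) (rsubmx (u - c *m T : 'rV_(1 + r)))).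
  by rewrite -w0 hsubmxK.
have vG : v *m G' = row_mx 0 (v *m G) by rewrite mul_mx_row mulmx0.
exists (row_mx c v); rewrite mul_row_col vG -hv -w0 hsubmxK.
by rewrite addrC subrK.
Qed.

Section Graded.
Variables (K : fieldType) (n : nat).
Local Notation S := {mpoly K[n]}.

Lemma pihomogM d e (f g : S) : g \is e.-homog ->
  pihomog mdeg d (f * g) = if (e <= d)%N then pihomog mdeg (d - e) f * g else 0.
Proof.
move=> hg; rewrite {1}[f](@pihomog_partitionE _ _ mdeg (msize f)) // mulr_suml.
rewrite (raddf_sum (pihomog mdeg d)).
have h i : pihomog mdeg d (pihomog mdeg i f * g) =
    if (i + e == d)%N then pihomog mdeg i f * g else 0.
  have hi := dhomogM (pihomogP mdeg i f) hg.
  case: eqVneq => [<-|ne]; first exact: pihomog_dE.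
  by rewrite (pihomog_ne0 _ hi).
rewrite (eq_bigr _ (fun (i : 'I_(msize f)) _ => h i)).
rewrite -big_mkcond /=; case: leqP => ed; last first.
  by rewrite big1 // => i /eqP ie; lia.
case: (ltnP (d - e) (msize f)) => dm.
  rewrite (big_pred1 (Ordinal dm)) // => i /=.
  by rewrite -(inj_eq val_inj) /=; apply/eqP/eqP; lia.
rewrite big1 => [|i /eqP ie]; last by have := ltn_ord i; lia.
suff -> : pihomog mdeg (d - e) f = 0 by rewrite mul0r.
apply/mpolyP => m; rewrite mcoeff_pihomog mcoeff0; case: eqP => // md.
by apply/memN_msupp_eq0/msize_mdeg_ge; rewrite md.
Qed.

(* Component of degree [d] in the direct sum of the S(- a k). *)
Definition hcomp r (a : 'I_r -> nat) d (u : 'rV[S]_r) : 'rV[S]_r :=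
  \row_k (if (a k <= d)%N then pihomog mdeg (d - a k) (u 0 k) else 0).

Section Component.
Variables (r : nat) (a : 'I_r -> nat).

Lemma hcomp_id d (u : 'rV[S]_r) : hcomp a d (hcomp a d u) = hcomp a d u.
Proof.
by apply/rowP => k; rewrite !mxE; case: (a k <= d)%N => //; rewrite pihomog_id.
Qed.

Lemma hcomp_sum (u : 'rV[S]_r) : exists B, u = \sum_(d < B) hcomp a d u.
Proof.
pose B := \max_k (a k + msize (u 0%R k))%N; exists B.
apply/rowP => k; rewrite summxE.
have kB : (a k + msize (u 0%R k) <= B)%N.
  exact: leq_bigmax (fun k => a k + msize (u 0%R k))%N k.
rewrite -(big_mkord xpredT (fun d => hcomp a d u 0 k)).
rewrite (big_cat_nat (n := a k)) ?(leq_trans _ kB) ?leq_addr //=.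
rewrite big_nat big1 => [|d /andP[_ dk]]; last by rewrite mxE leqNgt dk.
rewrite add0r -{1}[a k]add0n big_addn big_mkord.
rewrite {1}[u 0 k](@pihomog_partitionE _ _ mdeg (B - a k)); last first.
  by rewrite leq_subRL; lia.
by apply: eq_bigr => d _; rewrite mxE leq_addl addnK.
Qed.

End Component.

(** A matrix whose rows are homogeneous of degrees [b j] is a degree-preserving map between shifted
    free modules. *)
Lemma hcomp_mul p r (a : 'I_r -> nat) (b : 'I_p -> nat) (G : 'M[S]_(p, r)) :
    (forall j, hcomp a (b j) (row j G) = row j G) ->
  forall d v, hcomp a d (v *m G) = hcomp b d v *m G.
Proof.
move=> hG d v; apply/rowP => k; rewrite !mxE.
have Gjk j : G j k = if (a k <= b j)%N then pihomog mdeg (b j - a k) (G j k) else 0.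
  by have /rowP/(_ k) := hG j; rewrite !mxE.
case: ifP => akd; last first.
  rewrite big1 // => j _; rewrite mxE Gjk; case: ifP => bd; last by rewrite mul0r.
  by rewrite [(a k <= b j)%N](_ : _ = false) ?mulr0 //; apply/negbTE; lia.
rewrite raddf_sum /=; apply: eq_bigr => j _; rewrite mxE.
have := Gjk j; case: ifP => akb Ge; last first.
  by rewrite Ge !mulr0 raddf0.
have hGe : G j k \is (b j - a k).-homog by rewrite Ge pihomogP.
rewrite (pihomogM _ _ hGe) leq_sub2rE //; case: ifP => bd; last by rewrite mul0r.
by congr (pihomog _ _ _ * _); lia.
Qed.

Lemma zhomog_sub (a b : nat) (f : S) :
    f = (if (a <= b)%N then pihomog mdeg (b - a) f else 0) ->
  zhomog (b%:Z - a%:Z) f.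
Proof.
case: leqP => ab; first by rewrite subzn // => ->; exact: pihomogP.
have -> : b%:Z - a%:Z = Negz (a - b).-1.
  by rewrite NegzE prednK ?subn_gt0 // -subzn ?(ltnW ab) // opprB.
by move=> -> /=.
Qed.

Definition max_vector r (u : 'rV[S]_r) : Prop := forall k, (u 0 k)@_0 = 0.

Definition graded_submodule r (a : 'I_r -> nat) (U : 'rV[S]_r -> Prop) : Prop :=
  is_submodule U /\ forall d u, U u -> U (hcomp a d u).

Definition homog_generators r (a : 'I_r -> nat) (U : 'rV[S]_r -> Prop) p
    (b : 'I_p -> nat) (G : 'M[S]_(p, r)) : Prop :=
  (forall j, hcomp a (b j) (row j G) = row j G) /\
  (forall u, U u <-> exists v, u = v *m G).

(** Replace each member of a finite generating family by its homogeneous components; the new index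
    set consists of pairs of a generator and a degree. *)
Lemma exists_homog_generators r (a : 'I_r -> nat) (U : 'rV[S]_r -> Prop) :
    graded_submodule a U ->
  exists p (b : 'I_p -> nat) (G : 'M[S]_(p, r)), homog_generators a U b G.
Proof.
move=> [Usub Uhom].
have [p [G hG]] := noetherian_submodule (@noetherian_mpoly K n) Usub.
have /choice[B hB] := fun j => hcomp_sum a (row j G).
pose T := {j : 'I_p & 'I_(B j)}.
pose b (t : 'I_#|{: T}|) : nat := tagged (enum_val t).
pose G' := \matrix_(t < #|{: T}|) hcomp a (b t) (row (tag (enum_val t)) G).
have rowG j : U (row j G) by apply/hG; exists (delta_mx 0 j); rewrite rowE.
exists #|{: T}|, b, G'; split=> [t|u]; first by rewrite rowK hcomp_id.
split=> [/hG[v ->]|[v ->]]; last first.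
  by apply: submodule_mul => // t; rewrite rowK; apply: Uhom.
exists (\row_t v 0 (tag (enum_val t))).
rewrite !mulmx_sum_row.
transitivity (\sum_(t : T) v 0 (tag t) *: hcomp a (tagged t) (row (tag t) G)).
  rewrite -(sig_big_dep xpredT (fun _ => xpredT)
    (fun j (d : 'I_(B j)) => v 0 j *: hcomp a d (row j G))) /=.
  by apply: eq_bigr => j _; rewrite [in LHS](hB j) scaler_sumr.
rewrite (reindex (@enum_val T {: T})) /=; last first.
  by apply: onW_bij; exact: enum_val_bij.
by apply: eq_bigr => t _; rewrite rowK mxE.
Qed.

(* A homogeneous generating family of minimal size is minimal: a relation with
   an invertible coefficient has a homogeneous component expressing one of the
   generators in terms of the others. *)
Lemma exists_minimal_generators r (a : 'I_r -> nat) (U : 'rV[S]_r -> Prop) :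
    graded_submodule a U ->
  exists p (b : 'I_p -> nat) (G : 'M[S]_(p, r)),
    homog_generators a U b G /\ forall v, v *m G = 0 -> max_vector v.
Proof.
move=> Ugr; pose P p := `[< exists (b : 'I_p -> nat) (G : 'M[S]_(p, r)),
  homog_generators a U b G >].
have exP : exists p, P p.
  have [p [b [G h]]] := exists_homog_generators Ugr.
  by exists p; apply/asboolP; exists b, G.
case: (ex_minnP exP) => p /asboolP[b [G [Ghom Ggen]]] minp.
exists p, b, G; split=> // v vG j; apply: contrapT => vj.
case: p b G Ghom Ggen minp v vG j vj => [|p] b G Ghom Ggen minp v vG j vj; first by case: j vj.
suff /minp : P p by rewrite ltnn.
(* In degree [b j] the coordinate [j] of the relation reduces to its nonzero constant term [c], so
   the [j]-th generator can be solved for. *)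
pose w := hcomp b (b j) v.
have wG : w *m G = 0.
  by rewrite -(hcomp_mul Ghom) vG; apply/rowP => k; rewrite !mxE; case: ifP; rewrite ?raddf0.
pose c := (v 0 j)@_0.
have wj : w 0 j = c%:MP.
  rewrite mxE leqnn subnn; apply/mpolyP => m; rewrite mcoeff_pihomog mcoeffC.
  rewrite mdeg_eq0 eq_sym; case: eqP => [<-|_]; rewrite ?mulr1 ?mulr0 //.
have c0 : c != 0 by apply/eqP.
have rowj : row j G = (- c^-1)%:MP *: ((\row_i w 0 (lift j i)) *m row' j G).
  move: wG; rewrite mulmx_sum_row (bigD1_ord j) //= wj => wG.
  have -> : (\row_i w 0 (lift j i)) *m row' j G = - (c%:MP *: row j G).
    apply/eqP; rewrite -addr_eq0 addrC mulmx_sum_row; apply/eqP.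
    rewrite -[RHS]wG; congr (_ + _); apply: eq_bigr => i _; rewrite mxE.
    by congr (_ *: _); apply/rowP => k; rewrite !mxE.
  by rewrite scalerN scalerA -scaleNr -mpolyCM mulNr mulVf // mpolyCN opprK mpolyC1 scale1r.
apply/asboolP; exists (fun i => b (lift j i)), (row' j G); split=> [i|u].
  have -> : row i (row' j G) = row (lift j i) G by apply/rowP => k; rewrite !mxE.
  exact: Ghom.
rewrite Ggen; split=> [[x ->]|[x ->]].
  exists ((x 0 j * (- c^-1)%:MP) *: (\row_i w 0 (lift j i)) + \row_i x 0 (lift j i)).
  rewrite mulmxDl -scalemxAl -scalerA -rowj mulmx_sum_row (bigD1_ord j) //=.
  congr (_ + _); rewrite mulmx_sum_row; apply: eq_bigr => i _; rewrite mxE.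
  by congr (_ *: _); apply/rowP => k; rewrite !mxE.
exists (\row_i if unlift j i is Some k then x 0 k else 0).
rewrite [in RHS]mulmx_sum_row (bigD1_ord j) //= mxE unlift_none scale0r add0r.
rewrite mulmx_sum_row; apply: eq_bigr => i _; rewrite mxE liftK.
by congr (_ *: _); apply/rowP => k; rewrite !mxE.
Qed.

End Graded.

(** * The minimal graded free resolution of the coordinate ring *)

Section Resolution.
Variables (K : numFieldType) (n : nat) (M : line_collection K n).
Local Notation S := {mpoly K[n.+1]}.
Local Notation pi := (coord_ring_pi M).
Local Notation J := (lines_ideal M).

(** The state carried through the construction: a graded submodule of a shifted free module. The
    condition [syz_max] makes the next differential minimal. *)
Record syzygy := Syzygy {
  syz_rank : nat;
  syz_deg : 'I_syz_rank -> nat;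
  syz_mem : 'rV[S]_syz_rank -> Prop;
  syz_graded : graded_submodule syz_deg syz_mem;
  syz_max : forall u, syz_mem u -> max_vector u
}.

(** The relations among minimal homogeneous generators are the next syzygy module. The result is a
    sigma type so that the step can be iterated. *)
Lemma next_syzygy (s : syzygy) :
  {t : syzygy & {G : 'M[S]_(syz_rank t, syz_rank s) |
    homog_generators (@syz_deg s) (@syz_mem s) (@syz_deg t) G /\
    forall v, syz_mem v <-> v *m G = 0}}.
Proof.
have [p /cid[b /cid[G [hG minG]]]] := cid (exists_minimal_generators (syz_graded s)).
have gr : graded_submodule b (fun v => v *m G = 0).
  split; last by move=> d u; rewrite -(hcomp_mul hG.1) => ->;
    apply/rowP => k; rewrite !mxE; case: ifP; rewrite ?raddf0.
  split=> [|u v u0 v0|c u u0]; rewrite ?mul0mx //.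
    by rewrite mulmxDl u0 v0 addr0.
  by rewrite -scalemxAl u0 scaler0.
by exists (Syzygy gr minG), G.
Qed.

(** The ideal of the lines is graded because substitution commutes with taking homogeneous
    components. *)
Lemma line_syzygy0 :
  graded_submodule (fun _ : 'I_1 => 0%N) (fun u : 'rV[S]_1 => J (u 0 0)).
Proof.
split=> [|d u Ju l lM]; last first.
  by rewrite mxE subn0 -linsub_pihomog Ju // raddf0.
split=> [l lM|u v Ju Jv l lM|c u Ju l lM]; rewrite mxE ?raddf0 //.
  by rewrite raddfD /= Ju // Jv // addr0.
by rewrite rmorphM /= Ju // mulr0.
Qed.

Lemma line_syzygy0_max (u : 'rV[S]_1) : J (u 0 0) -> max_vector u.
Proof. by move=> Ju k; rewrite ord1; exact: lines_ideal_mcoeff0 Ju. Qed.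

Definition syz0 := Syzygy line_syzygy0 line_syzygy0_max.
Definition syz i : syzygy := iter i (fun s => projT1 (next_syzygy s)) syz0.
Definition syz_diff i : 'M[S]_(syz_rank (syz i.+1), syz_rank (syz i)) :=
  sval (projT2 (next_syzygy (syz i))).

Definition pi_row (u : 'rV[S]_1) : coord_ring M := pi (u 0 0).

Lemma pi_row_linear : linear pi_row.
Proof.
by move=> a u v; rewrite /pi_row !mxE coord_ring_piD -coord_ring_scaleE.
Qed.
HB.instance Definition _ := GRing.isLinear.Build S 'rV[S]_1 (coord_ring M) *:%R
  pi_row pi_row_linear.

Definition line_resolution : free_complex (coord_ring M) :=
  @FreeComplex K n.+1 (coord_ring M) (fun i => syz_rank (syz i))
    (fun i j => Posz (syz_deg j)) syz_diff pi_row.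

(** Exactness holds because each syzygy module is both the image of the next differential and the
    kernel of the preceding map. Minimality holds because rows of a differential lie in a syzygy
    module. *)
Lemma line_resolution_minimal :
  minimal_graded_free_resolution (@coord_ring_deg K n M) line_resolution.
Proof.
have gens i := (svalP (projT2 (next_syzygy (syz i)))).1.
have kers i := (svalP (projT2 (next_syzygy (syz i)))).2.
split.
- split=> [i j k|k].
    apply: zhomog_sub; have [/(_ j)/rowP/(_ k) e _] := gens i.
    by move: e; rewrite !mxE.
  exists 1; first exact: dhomog1.
  by rewrite /= /pi_row mxE (ord1 k) !eqxx.
- split=> [x|u|i u].
  + have [f ->] := coord_ring_pi_surj x; exists (const_mx f).
    by rewrite /= /pi_row mxE.
  + by rewrite -((gens 0%N).2 u) /= /pi_row coord_ring_pi_eq0.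
  by rewrite -(kers i u) -((gens i.+1).2 u).
move=> i j k; apply/max_homog_idealP.
have /syz_max/(_ k) : syz_mem (row j (syz_diff i)).
  by apply/(gens i).2; exists (delta_mx 0 j); rewrite rowE.
by rewrite mxE.
Qed.

End Resolution.

(** * Uniqueness of depth and dimension, and the invariants of the coordinate ring *)

Lemma has_depth_unique (A : comNzRingType) (V : lmodType A) (I : A -> Prop) d d' :
  has_depth V I d -> has_depth V I d' -> d = d'.
Proof.
move=> [[s [hs sd]] max] [[s' [hs' sd']] max']; apply/eqP.
by rewrite eqn_leq -{1}sd -{2}sd' max' // max.
Qed.

Lemma has_krull_dim_unique (A : comNzRingType) d d' :
  has_krull_dim A d -> has_krull_dim A d' -> d = d'.
Proof.
move=> [[P cP] max] [[P' cP'] max']; apply/eqP.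
by rewrite eqn_leq (max' _ P cP) (max _ P' cP').
Qed.

Theorem proposition3p1 (R : realType) (n : nat) (hn : (3 <= n)%N)
    (M : line_collection R[i] n) (hM : general_linear_position M) :
  (#|` M| = 1%N ->
     has_coord_pdim M (n - 1) /\ has_coord_depth M 2 /\ has_coord_dim M 2) /\
  ((2 <= #|` M|)%N ->
     has_coord_pdim M n /\ has_coord_depth M 1 /\ has_coord_dim M 2) /\
  (cohen_macaulay M <-> #|` M| = 1%N).
Proof.
have one : #|` M| = 1%N ->
    has_coord_pdim M (n - 1) /\ has_coord_depth M 2 /\ has_coord_dim M 2.
  move=> /eqP/cardfs1P[l Ml]; split; last first.
    by split; [exact: depth_one Ml | exact: krull_dim_lines].
  split; first by exists (line_resolution M); exact: line_resolution_minimal.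
  by move=> F hF; exact: length_one hF _ (ltnW hn) Ml.
have many : (2 <= #|` M|)%N ->
    has_coord_pdim M n /\ has_coord_depth M 1 /\ has_coord_dim M 2.
  move=> M2; split; last first.
    by split; [exact: depth_many | exact: krull_dim_lines].
  split; first by exists (line_resolution M); exact: line_resolution_minimal.
  by move=> F hF; apply: length_many hF hn hM M2.
split=> //; split=> //; split=> [[d [dep dim]]|/one[_ [dep dim]]]; last by exists 2.
case: (ltngtP #|` M| 1) => // [|/many[_ [dep1 dim2]]].
  by rewrite ltnS leqn0 cardfs_eq0 => /eqP M0; move: (lines_neq0 M); rewrite M0 eqxx.
(* A common value of depth and dimension would equal both 1 and 2. *)
have := has_depth_unique dep dep1.
by rewrite (has_krull_dim_unique dim dim2).
Qed.
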